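(* Let $\rho>0$ and let $p_n(t)$, $n\ge 0$, be the conditional sojourn time density in the $M/M/1$ processor sharing queue with balking $b_n=1/(n+1)$ (service rate $1$, arrival rate $\rho$). Then $p_n(t)$ has the exact (spectral) representation $$p_n(t)=\sum_{m=1}^\infty C_m(\nu_m)\,\phi_m(n,\nu_m)\,e^{\nu_m t}+\sum_{m=1}^\infty C_m(\widetilde{\nu}_m)\,\phi_m(n,\widetilde{\nu}_m)\,e^{\widetilde{\nu}_m t},$$ where $$\nu_m=-1+\frac{1}{2m}\Big[-\rho+\sqrt{\rho^2+4m\rho}\Big],\qquad \widetilde{\nu}_m=-1+\frac{1}{2m}\Big[-\rho-\sqrt{\rho^2+4m\rho}\Big],$$ $$C_m(\nu)=\frac{m^{m-1}}{m!}\,\frac{\nu}{\nu-1}\,e^{-m},\qquad \phi_m(n,\nu)=n!\,\Big(\frac{\nu+1}{-\rho}\Big)^n L^{(m-1-n)}_n\Big(\frac{\rho}{(\nu+1)^2}\Big).$$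
   Context: $\mathcal{V}_n$ denotes the sojourn time of a tagged customer who enters the PS queue and finds $n$ other customers present, and $\mathbf{V}_n(t)=\mathrm{Prob}[\mathcal{V}_n>t]$. With $b_n=1/(n+1)$, the functions $\mathbf{V}_n$ ($n\ge 0$, $t\ge 0$, $0\le \mathbf V_n\le 1$) are the bounded solution of $$\mathbf{V}'_n(t)=\frac{n}{n+1}\mathbf{V}_{n-1}(t)-\Big(1+\frac{\rho}{n+1}\Big)\mathbf{V}_n(t)+\frac{\rho}{n+1}\mathbf{V}_{n+1}(t),\qquad \mathbf{V}_n(0)=1.$$ The conditional sojourn time density is $p_n(t)=-\mathbf{V}_n'(t)$; equivalently $$p'_n(t)=\frac{n}{n+1}p_{n-1}(t)-\Big(1+\frac{\rho}{n+1}\Big)p_n(t)+\frac{\rho}{n+1}p_{n+1}(t),\quad t>0,\qquad p_n(0)=\frac{1}{n+1},\quad n\ge 0$$ (the term with $p_{n-1}$ is absent for $n=0$). $L_n^{(\alpha)}(z)=\sum_{k=0}^n\binom{n+\alpha}{n-k}\frac{(-z)^k}{k!}$ is the generalized Laguerre polynomial, for arbitrary real $\alpha$ (with generalized binomial coefficients); equivalently $\sum_{n\ge0}L_n^{(\alpha-n)}(x)w^n=(1+w)^\alpha e^{-wx}$. *)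

(* Defs.v *)
From Stdlib Require Import Factorial Reals.
From Coquelicot Require Import Coquelicot.
Open Scope R_scope.

(* [is_derive] with the neighbourhoods of [t] restricted to [0, +oo): the
   usual two-sided derivative for t > 0, the right derivative for t = 0. *)
Definition is_derive_nonneg (f : R -> R) (t l : R) : Prop :=
  filterdiff f (within (fun s => 0 <= s) (locally t)) (fun h => scal h l).

(* V n t = Prob[sojourn time > t] for a tagged customer who finds n others in
   the M/M/1-PS queue with service rate 1, arrival rate rho and balking
   b_n = 1/(n+1).  For n = 0 the coefficient of V (pred 0) is 0, so that term
   is absent, as it should be. *)
Definition sojourn_tail (rho : R) (V : nat -> R -> R) : Prop :=
  (forall n, V n 0 = 1) /\
  (forall n t, 0 <= t -> 0 <= V n t <= 1) /\
  (forall n t, 0 <= t ->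
     is_derive_nonneg (V n) t
       (INR n / (INR n + 1) * V (pred n) t
        - (1 + rho / (INR n + 1)) * V n t
        + rho / (INR n + 1) * V (S n) t)).

Definition sojourn_density (rho : R) (p : nat -> R -> R) : Prop :=
  exists V : nat -> R -> R,
    sojourn_tail rho V /\
    forall n t, 0 <= t -> is_derive_nonneg (V n) t (- p n t).

(* Generalized binomial coefficient a (a-1) ... (a-k+1) / k! for real a. *)
Fixpoint gbinom (a : R) (k : nat) : R :=
  match k with
  | O => 1
  | S j => gbinom a j * (a - INR j) / INR (S j)
  end.

Definition laguerre (n : nat) (alpha z : R) : R :=
  sum_f_R0 (fun k => gbinom (INR n + alpha) (n - k) * ((- z) ^ k / INR (fact k))) n.

Definition nu (rho : R) (m : nat) : R :=
  -1 + 1 / (2 * INR m) * (- rho + sqrt (rho ^ 2 + 4 * INR m * rho)).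

Definition nu_tilde (rho : R) (m : nat) : R :=
  -1 + 1 / (2 * INR m) * (- rho - sqrt (rho ^ 2 + 4 * INR m * rho)).

Definition Ccoef (m : nat) (v : R) : R :=
  INR m ^ (m - 1) / INR (fact m) * (v / (v - 1)) * exp (- INR m).

Definition phi (rho : R) (m n : nat) (v : R) : R :=
  INR (fact n) * ((v + 1) / - rho) ^ n
  * laguerre n (INR m - 1 - INR n) (rho / (v + 1) ^ 2).

Definition spectral_term (rho : R) (n : nat) (t : R) (m : nat) (v : R) : R :=
  Ccoef m v * phi rho m n v * exp (v * t).

(* Main.v *)
Require Import Defs.
From Stdlib Require Import Factorial Reals Lra Lia.
From Coquelicot Require Import Coquelicot.
Open Scope R_scope.

(** The tails V_n solve V' = A V, V(0) = 1, with A a birth and death generator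
    with killing. Its rates are bounded, so a bounded solution is exp (t A)
    applied to 1, and p_n(t) is determined by the numbers (A^k p(0))_n. The
    functions phi_m(n, nu) are eigenvectors of A with eigenvalue nu: as
    functions of n they satisfy the three-term recurrence
    rho Q_(n+1) = ((n+1) x + rho) Q_n - n Q_(n-1) with x = nu + 1, by the
    recurrence of the Laguerre polynomials and the quadratic equation
    m x^2 + rho x - rho = 0 of the eigenvalues. Hence they are values of one
    family of polynomials Q_n(x) (phi_eq_spectral_poly), bounded on the
    spectrum for fixed n, and the claimed expansion is the integral of
    Q_n(x) exp ((x-1) t) against the measure with mass C_m at the shifted
    eigenvalues. As A acts on Q_n as multiplication by x - 1, the theorem
    reduces to the case t = 0: the integral of Q_n is 1 / (n+1)
    (spectral_mean_poly).

    The two masses attached to m add up to the Borel weight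
    b_m = m^(m-1) exp (-m) / m!. Let E denote the mean for these weights and
    e_i(m) = (1 - 1/m) ... (1 - i/m). The tree function T, the inverse of
    u exp (-u), has T^(i+1) / (i+1) = sum of m^(m-1) / m! e_i(m) q^m. At the
    boundary point q = 1/e, where T = 1, this gives E e_i = 1 / (i+1)
    (borel_mean_fall_ratio). The expansions of the powers of T follow from the
    equation q T' (1 - T) = T, which is Abel's binomial identity.

    To pass from e_i to Q_n, consider the integral A_n(z) of
    Q_n(x) / (1 - x z), essentially the Laplace transform of the claimed
    expansion. For n = 0 the two eigenvalues of each m combine to
    E (M / (M + K)) with K = rho z (1 - z). On the other side, the Laplace
    transform of the true density is, up to a factor, the integral over [0, 1]
    of (z + (1 - z) u)^n (u exp (1 - u))^K, and its expansion in terms of the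
    numbers E (e_i(M) M / (M + K)) gives a family W_n(z) with W_0 = A_0. The
    two families satisfy the same recurrence in n, except that the constant
    term is (n+1) times the integral of Q_n for A_n and 1 for W_n. The constant
    terms agree because the remaining terms are O(z) (spectral_mean_poly_step),
    and this is the required normalisation. *)

(** * Finite sums, factorials and powers *)

Lemma INR_fact_pos (n : nat) : 0 < INR (fact n).
Proof. apply lt_0_INR, lt_O_fact. Qed.

Lemma INR_fact_S (n : nat) : INR (fact (S n)) = (INR n + 1) * INR (fact n).
Proof. rewrite fact_simpl, mult_INR, S_INR. reflexivity. Qed.

Lemma sum_n_R_ext (f g : nat -> R) (n : nat) :
  (forall k, (k <= n)%nat -> f k = g k) -> sum_n f n = sum_n g n :> R.
Proof. intros H. apply sum_n_ext_loc. exact H. Qed.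

Lemma sum_n_R_scal (c : R) (f : nat -> R) (n : nat) :
  sum_n (fun k => c * f k) n = c * sum_n f n :> R.
Proof. exact (sum_n_mult_l c f n). Qed.

Lemma sum_n_R_plus (f g : nat -> R) (n : nat) :
  sum_n (fun k => f k + g k) n = sum_n f n + sum_n g n :> R.
Proof. exact (sum_n_plus f g n). Qed.

Lemma sum_n_R_shift (f : nat -> R) (n : nat) :
  sum_n f (S n) = f 0%nat + sum_n (fun k => f (S k)) n :> R.
Proof.
  unfold sum_n. rewrite sum_n_m_Chasles with (m := 0%nat) by lia.
  rewrite sum_n_n, <- sum_n_m_S. reflexivity.
Qed.

Lemma is_series_R_ext (a b : nat -> R) (l : R) :
  (forall n, a n = b n) -> is_series a l -> is_series b l.
Proof. exact (is_series_ext a b l). Qed.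

Lemma ex_series_R_scal (c : R) (a : nat -> R) :
  ex_series a -> ex_series (fun n => c * a n).
Proof. exact (ex_series_scal_l c a). Qed.

Lemma eq_of_derive_0 (f : R -> R) (a b : R) :
  (forall t, a <= t <= b -> is_derive f t 0) -> a < b -> f a = f b.
Proof. exact (eq_is_derive f a b). Qed.

Lemma is_derive_pow_fact (c z : R) (j : nat) :
  is_derive (fun y => (y - c) ^ S j / INR (fact (S j))) z
    ((z - c) ^ j / INR (fact j)).
Proof.
  assert (H := INR_fact_pos j). assert (H' := pos_INR j).
  rewrite INR_fact_S. set (d := (INR j + 1) * INR (fact j)).
  auto_derive; [easy|].
  change (match j with O => 1 | S _ => INR j + 1 end) with (INR (S j)).
  rewrite S_INR. unfold d, Rminus. field. lra.
Qed.

Lemma is_derive_pow_fact0 (z : R) (j : nat) :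
  is_derive (fun y => y ^ S j / INR (fact (S j))) z (z ^ j / INR (fact j)).
Proof.
  apply is_derive_ext with (fun y => (y - 0) ^ S j / INR (fact (S j))).
  - intros y. now rewrite Rminus_0_r.
  - rewrite <- (Rminus_0_r z) at 2. apply is_derive_pow_fact.
Qed.

(** * Abel's identity *)

Definition diff_term (n j : nat) (x : R) (k : nat) : R :=
  (-1) ^ (n - k) * (x + INR k) ^ j / (INR (fact k) * INR (fact (n - k))).

(** An n-th finite difference lowers degrees by n. The induction lowers the
    exponent instead: in (x + k)^(j+1) = x (x + k)^j + k (x + k)^j the factor
    k cancels against k!, which leaves the same sum with n - 1 and x + 1. *)
Lemma finite_difference_pow (j n : nat) (x : R) :
  (j < n)%nat -> sum_n (diff_term n j x) n = 0 :> R.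
Proof.
  revert n x. induction j as [|j IH]; intros n x Hjn.
  - assert (Hb := binomial 1 (-1) n). replace (1 + -1) with 0 in Hb by ring.
    rewrite pow_i in Hb by lia. rewrite <- sum_n_Reals in Hb.
    transitivity (/ INR (fact n) * 0); [rewrite Hb, <- sum_n_R_scal | ring].
    apply sum_n_R_ext. intros k Hk. unfold diff_term, Binomial.C.
    assert (H1 := INR_fact_pos k). assert (H2 := INR_fact_pos (n - k)).
    assert (H3 := INR_fact_pos n). rewrite pow1. simpl pow. field. lra.
  - destruct n as [|n]; [lia|].
    transitivity (x * sum_n (diff_term (S n) j x) (S n)
                  + sum_n (diff_term n j (x + 1)) n).
    2: { rewrite !IH by lia. ring. }
    transitivity (x * sum_n (diff_term (S n) j x) (S n)
                  + sum_n (fun k => INR k * diff_term (S n) j x k) (S n)).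
    + rewrite <- sum_n_R_scal, <- sum_n_R_plus. apply sum_n_R_ext.
      intros k Hk. unfold diff_term. simpl pow. unfold Rdiv. ring.
    + f_equal. rewrite sum_n_R_shift. simpl INR at 1. rewrite Rmult_0_l, Rplus_0_l.
      apply sum_n_R_ext. intros k Hk. unfold diff_term.
      replace (S n - S k)%nat with (n - k)%nat by lia.
      rewrite INR_fact_S, S_INR.
      assert (H1 := INR_fact_pos k). assert (H2 := INR_fact_pos (n - k)).
      assert (H3 := pos_INR k).
      replace (x + (INR k + 1)) with (x + 1 + INR k) by ring.
      field. lra.
Qed.

(** Coefficients of the exponential generating function of rooted labelled
    trees, the inverse function of u exp (-u) on [0, 1]. *)
Definition tree_coef (m : nat) : R :=
  match m with
  | O => 0
  | S k => INR m ^ k / INR (fact m)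
  end.

Lemma tree_coef_S (k : nat) :
  tree_coef (S k) = INR (S k) ^ k / INR (fact (S k)).
Proof. reflexivity. Qed.

(** Differentiating in y lowers n by one, so by induction it suffices to
    compare the two sides at y = 0, where the left-hand side is an n-th finite
    difference of a power of smaller degree. *)
Lemma abel_identity (n : nat) (y : R) :
  sum_n (fun k => tree_coef k * ((y - INR k) ^ (S n - k) / INR (fact (S n - k)))) (S n)
  = y ^ n / INR (fact n) :> R.
Proof.
  revert y. induction n as [|n IH]; intros y.
  - rewrite sum_Sn, sum_O. unfold plus. simpl. field.
  - set (g := fun y => sum_n (fun k => tree_coef k *
        ((y - INR k) ^ (S (S n) - k) / INR (fact (S (S n) - k)))) (S (S n))).
    assert (Hd : forall z, is_derive (fun y => g y - y ^ S n / INR (fact (S n))) z 0).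
    { intros z.
      replace 0 with (sum_n (fun k => tree_coef k *
        ((z - INR k) ^ (S n - k) / INR (fact (S n - k)))) (S n) - z ^ n / INR (fact n))
        by (rewrite IH; ring).
      apply (is_derive_minus g (fun y => y ^ S n / INR (fact (S n)))).
      - replace (sum_n _ (S n)) with
          (sum_n (fun k => match (S (S n) - k)%nat with O => 0 | S j =>
             tree_coef k * ((z - INR k) ^ j / INR (fact j)) end) (S (S n))).
        + apply (is_derive_sum_n (fun k y => tree_coef k *
            ((y - INR k) ^ (S (S n) - k) / INR (fact (S (S n) - k))))).
          intros k Hk. destruct (S (S n) - k)%nat as [|j].
          * auto_derive; [easy|]. simpl. field.
          * apply (is_derive_scal (fun y => (y - INR k) ^ S j / INR (fact (S j)))).
            apply is_derive_pow_fact.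
        + rewrite sum_Sn. rewrite Nat.sub_diag. unfold plus; simpl (_ + 0).
          rewrite Rplus_0_r.
          apply sum_n_R_ext. intros k Hk.
          replace (S (S n) - k)%nat with (S (S n - k)) by lia. reflexivity.
      - apply is_derive_pow_fact0. }
    assert (H0 : g 0 - 0 ^ S n / INR (fact (S n)) = 0).
    { rewrite pow_i by lia. unfold Rdiv. rewrite Rmult_0_l, Rminus_0_r.
      transitivity (sum_n (diff_term (S (S n)) (S n) 0) (S (S n)));
        [|apply finite_difference_pow; lia].
      apply sum_n_R_ext. intros k Hk. unfold diff_term.
      rewrite Rplus_0_l. destruct k as [|k].
      - simpl tree_coef. simpl INR. rewrite (pow_i (S n)) by lia. unfold Rdiv. ring.
      - rewrite tree_coef_S, Rminus_0_l.
        replace (- INR (S k)) with ((-1) * INR (S k)) by ring.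
        rewrite Rpow_mult_distr.
        assert (E : INR (S k) ^ S n = INR (S k) ^ k * INR (S k) ^ (S (S n) - S k)).
        { rewrite <- pow_add. f_equal. lia. }
        rewrite E.
        assert (H1 := INR_fact_pos (S k)). assert (H2 := INR_fact_pos (S (S n) - S k)).
        field. lra. }
    assert (E : g y - y ^ S n / INR (fact (S n)) = 0).
    { destruct (Rtotal_order y 0) as [Hy|[Hy|Hy]].
      - rewrite <- H0.
        apply (eq_is_derive (fun y => g y - y ^ S n / INR (fact (S n))) y 0); [|exact Hy].
        intros z _. apply Hd.
      - subst y. exact H0.
      - rewrite <- H0. symmetry.
        apply (eq_is_derive (fun y => g y - y ^ S n / INR (fact (S n))) 0 y); [|exact Hy].
        intros z _. apply Hd. }
    change (g y = y ^ S n / INR (fact (S n))). lra.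
Qed.

Lemma tree_coef_mul_INR (n : nat) :
  INR (S n) * tree_coef (S n) = INR (S n) ^ S n / INR (fact (S n)).
Proof. rewrite tree_coef_S, <- tech_pow_Rmult. unfold Rdiv. ring. Qed.

Lemma tree_coef_pos (n : nat) : 0 <= tree_coef n.
Proof.
  destruct n as [|n]; [simpl; lra|]. rewrite tree_coef_S.
  apply Rmult_le_pos; [apply pow_le, pos_INR|].
  left. apply Rinv_0_lt_compat, INR_fact_pos.
Qed.

(** Abel's identity at y = n, with the term k = n set apart: there (y - k)^0 =
    1, while (n - k) tree_coef (n - k) vanishes. *)
Lemma tree_coef_convolution (n : nat) :
  PS_mult tree_coef (fun m => INR m * tree_coef m) n
  = INR n * tree_coef n - tree_coef n.
Proof.
  unfold PS_mult. rewrite <- sum_n_Reals.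
  destruct n as [|n]; [rewrite sum_O; simpl; ring|].
  assert (H := abel_identity n (INR (S n))).
  rewrite sum_Sn in H |- *. rewrite Nat.sub_diag in H |- *.
  change plus with Rplus in *.
  assert (E : sum_n (fun k => tree_coef k *
     ((INR (S n) - INR k) ^ (S n - k) / INR (fact (S n - k)))) n =
     sum_n (fun k => tree_coef k * (INR (S n - k) * tree_coef (S n - k))) n).
  { apply sum_n_R_ext. intros k Hk. rewrite <- minus_INR by lia.
    destruct (S n - k)%nat as [|j] eqn:Ej; [lia|]. now rewrite tree_coef_mul_INR. }
  rewrite E in H.
  assert (E2 : INR (S n) ^ n / INR (fact n) = INR (S n) * tree_coef (S n)).
  { rewrite tree_coef_S, INR_fact_S, S_INR.
    assert (H1 := INR_fact_pos n). assert (H2 := pos_INR n). field. lra. }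
  rewrite E2 in H. simpl pow in H. simpl (INR (fact 0)) in H. simpl (INR 0).
  lra.
Qed.

(** * The tree function *)

Lemma pow_le_fact_exp (x : R) (n : nat) : 0 <= x -> x ^ n / INR (fact n) <= exp x.
Proof.
  intros Hx. revert x Hx. induction n as [|n IH]; intros x Hx.
  - simpl. assert (H := exp_ineq1_le x). lra.
  - destruct Hx as [Hx|Hx].
    2: { subst x. rewrite pow_i by lia. unfold Rdiv. rewrite Rmult_0_l.
         left. apply exp_pos. }
    set (f := fun x => exp x - x ^ S n / INR (fact (S n))).
    assert (Hd : forall z, is_derive f z (exp z - z ^ n / INR (fact n))).
    { intros z. unfold f. apply (is_derive_minus exp (fun z => z ^ S n / INR (fact (S n)))).
      - apply is_derive_Reals, derivable_pt_lim_exp.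
      - apply is_derive_pow_fact0. }
    destruct (MVT_gen f 0 x (fun z => exp z - z ^ n / INR (fact n))) as [c [Hc E]].
    + intros z _. apply Hd.
    + intros z _. apply continuity_pt_filterlim.
      apply (ex_derive_continuous f). eexists. apply Hd.
    + rewrite Rmin_left, Rmax_right in Hc by lra.
      assert (H := IH c (proj1 Hc)). rewrite Rminus_0_r in E.
      assert (0 <= (exp c - c ^ n / INR (fact n)) * x) by nra.
      unfold f in E. rewrite exp_0, (pow_i (S n)) in E by lia.
      unfold Rdiv in E at 2. rewrite Rmult_0_l in E. lra.
Qed.

Lemma tree_coef_le_exp (n : nat) : tree_coef n <= exp (INR n).
Proof.
  destruct n as [|n]; [simpl; left; apply exp_pos|].
  apply Rle_trans with (INR (S n) ^ S n / INR (fact (S n)));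
    [|apply pow_le_fact_exp, pos_INR].
  rewrite <- tree_coef_mul_INR.
  assert (H := tree_coef_pos (S n)). rewrite S_INR. assert (H' := pos_INR n).
  nra.
Qed.

Lemma exp_INR_pow (x : R) (n : nat) : exp (INR n * x) = exp x ^ n.
Proof.
  induction n as [|n IH]; [simpl; rewrite Rmult_0_l; apply exp_0|].
  rewrite S_INR, Rmult_plus_distr_r, exp_plus, IH, Rmult_1_l. simpl. ring.
Qed.

(** The radius of convergence is at least 1/e because m^m / m! is one term of
    the series of exp m. *)
Lemma CV_radius_below_tree (a : nat -> R) (x : R) :
  (forall n, Rabs (a n) <= tree_coef n) -> Rabs x < exp (-1) ->
  Rbar_lt (Rabs x) (CV_radius a).
Proof.
  intros Ha Hx. apply Rbar_lt_le_trans with (exp (-1)); [exact Hx|].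
  apply CV_radius_bounded. exists 1. intros n.
  rewrite <- exp_INR_pow, Rabs_mult, (Rabs_pos_eq (exp _)) by (left; apply exp_pos).
  replace 1 with (exp (INR n) * exp (INR n * -1))
    by (rewrite <- exp_plus, <- exp_0; f_equal; ring).
  apply Rmult_le_compat_r; [left; apply exp_pos|].
  eapply Rle_trans; [apply Ha|apply tree_coef_le_exp].
Qed.

Lemma Rabs_tree_coef_le (n : nat) : Rabs (tree_coef n) <= tree_coef n.
Proof. rewrite Rabs_pos_eq; [lra|apply tree_coef_pos]. Qed.

Lemma PSeries_mul_derive (a : nat -> R) (x : R) :
  x * PSeries (PS_derive a) x = PSeries (fun n => INR n * a n) x.
Proof.
  rewrite <- PSeries_incr_1. apply PSeries_ext. intros [|n]; [|reflexivity].
  simpl. unfold zero; simpl. ring.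
Qed.

(** The convolution identity read on generating functions. It is the
    derivative of tree x = x exp (tree x) with the exponential eliminated. *)
Lemma tree_ode (x : R) : Rabs x < exp (-1) ->
  x * PSeries (PS_derive tree_coef) x * (1 - PSeries tree_coef x)
  = PSeries tree_coef x.
Proof.
  intros Hx.
  assert (HR := CV_radius_below_tree tree_coef x Rabs_tree_coef_le Hx).
  assert (HR' : Rbar_lt (Rabs x) (CV_radius (fun n => INR n * tree_coef n))).
  { rewrite (CV_radius_ext _ (PS_incr_1 (PS_derive tree_coef))).
    - now rewrite CV_radius_incr_1, CV_radius_derive.
    - intros [|n]; [|reflexivity]. simpl. unfold zero; simpl. ring. }
  assert (E := PSeries_mult _ _ x HR HR').
  rewrite (PSeries_ext _ _ x tree_coef_convolution) in E.
  change (fun n => INR n * tree_coef n - tree_coef n)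
    with (PS_minus (fun n => INR n * tree_coef n) tree_coef) in E.
  rewrite PSeries_minus in E by (apply CV_radius_inside; assumption).
  rewrite PSeries_mul_derive. lra.
Qed.

Definition tree (x : R) : R := PSeries tree_coef x.

Lemma is_derive_below_tree (a : nat -> R) (x : R) :
  (forall n, Rabs (a n) <= tree_coef n) -> Rabs x < exp (-1) ->
  is_derive (PSeries a) x (PSeries (PS_derive a) x).
Proof. intros Ha Hx. now apply is_derive_PSeries, CV_radius_below_tree. Qed.

Lemma tree_0 : tree 0 = 0.
Proof. unfold tree. now rewrite PSeries_0. Qed.

Lemma tree_eq_exp (x : R) : 0 <= x < exp (-1) -> tree x = x * exp (tree x).
Proof.
  intros Hx.
  (* g = tree / id; the goal amounts to g exp (- tree) being constant *)
  set (g := PSeries (PS_decr_1 tree_coef)).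
  set (g' := PSeries (PS_derive (PS_decr_1 tree_coef))).
  set (f' := PSeries (PS_derive tree_coef)).
  assert (Hf : forall z, Rabs z < exp (-1) -> tree z = z * g z).
  { intros z Hz. unfold tree, g. rewrite PSeries_decr_1; [simpl (tree_coef 0); ring|].
    apply CV_radius_inside, CV_radius_below_tree; [apply Rabs_tree_coef_le|exact Hz]. }
  assert (Dg : forall z, Rabs z < exp (-1) -> is_derive g z (g' z)).
  { intros z Hz. apply is_derive_PSeries. rewrite CV_radius_decr_1.
    apply CV_radius_below_tree; [apply Rabs_tree_coef_le|exact Hz]. }
  assert (Df : forall z, Rabs z < exp (-1) -> is_derive tree z (f' z)).
  { intros z Hz. apply is_derive_below_tree; [apply Rabs_tree_coef_le|exact Hz]. }
  assert (Ef : forall z, Rabs z < exp (-1) -> f' z = g z + z * g' z).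
  { intros z Hz.
    transitivity (Derive tree z); [symmetry; apply is_derive_unique, Df, Hz|].
    apply is_derive_unique.
    apply is_derive_ext_loc with (fun z => z * g z).
    - assert (Hp : 0 < exp (-1) - Rabs z) by lra.
      exists (mkposreal _ Hp). intros w Hw. symmetry. apply Hf.
      change (Rabs (w - z) < exp (-1) - Rabs z) in Hw.
      replace w with (w - z + z) by ring.
      eapply Rle_lt_trans; [apply Rabs_triang|]. lra.
    - replace (g z + z * g' z) with (1 * g z + z * g' z) by ring.
      apply (is_derive_mult (fun z => z) g);
        [apply (is_derive_id z)|apply Dg, Hz|intros; apply Rmult_comm]. }
  assert (Eg : forall z, 0 <= z < exp (-1) -> g' z = g z * f' z).
  { intros z [[Hz|Hz] Hz1].
    - assert (Hz2 : Rabs z < exp (-1)) by (rewrite Rabs_pos_eq; lra).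
      assert (O := tree_ode z Hz2). fold f' in O. fold (tree z) in O.
      rewrite (Hf z Hz2) in O.
      assert (E := Ef z Hz2).
      apply Rmult_eq_reg_l with (z * z); [|nra].
      rewrite E in O |- *. nra.
    (* the differential equation degenerates at 0; compare coefficients there *)
    - subst z. unfold g', g, f'. rewrite !PSeries_0.
      unfold PS_derive, PS_decr_1. simpl. field. }
  assert (Hg : g x * exp (- tree x) = 1).
  { assert (H0 : g 0 * exp (- tree 0) = 1).
    { rewrite tree_0, Ropp_0, exp_0. unfold g. rewrite PSeries_0.
      unfold PS_decr_1. simpl. field. }
    destruct (proj1 Hx) as [Hx0|Hx0]; [|subst x; exact H0].
    rewrite <- H0. symmetry.
    apply (eq_of_derive_0 (fun z => g z * exp (- tree z)) 0 x); [|exact Hx0].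
    intros z Hz. assert (Hz1 : 0 <= z < exp (-1)) by lra.
    assert (Hz2 : Rabs z < exp (-1)) by (rewrite Rabs_pos_eq; lra).
    replace 0 with (g' z * exp (- tree z) + g z * (- f' z * exp (- tree z))).
    2:{ rewrite (Eg z Hz1). ring. }
    apply (is_derive_mult g (fun z => exp (- tree z)));
      [apply Dg, Hz2| |intros; apply Rmult_comm].
    apply (is_derive_comp exp (fun z => - tree z)).
    - apply is_derive_Reals, derivable_pt_lim_exp.
    - apply (is_derive_opp tree). apply Df, Hz2. }
  rewrite Hf at 1 by (rewrite Rabs_pos_eq; lra).
  f_equal. rewrite exp_Ropp in Hg.
  assert (H := exp_pos (tree x)).
  apply Rmult_eq_reg_r with (/ exp (tree x)); [|apply Rgt_not_eq, Rinv_0_lt_compat, H].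
  rewrite Hg. field. lra.
Qed.

Lemma PSeries_nonneg (a : nat -> R) (x : R) :
  (forall n, 0 <= a n) -> 0 <= x -> ex_pseries a x -> 0 <= PSeries a x.
Proof.
  intros Ha Hx Hex. unfold PSeries.
  rewrite <- (is_series_unique (fun _ => 0) 0).
  - apply Series_le.
    + intros n. split; [lra|]. apply Rmult_le_pos; [apply Ha|apply pow_le, Hx].
    + apply ex_pseries_R, Hex.
  - apply is_series_Reals. intros e He. exists 0%nat. intros n _.
    rewrite (sum_eq_R0 (fun _ => 0) n) by reflexivity.
    unfold Rdist. rewrite Rminus_0_r, Rabs_R0. exact He.
Qed.

(** Since x tree' and tree are nonnegative, x tree' (1 - tree) = tree > 0
    leaves no room for tree x >= 1. *)
Lemma tree_lt_1 (x : R) : 0 <= x < exp (-1) -> 0 <= tree x < 1.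
Proof.
  intros Hx.
  assert (Hx2 : Rabs x < exp (-1)) by (rewrite Rabs_pos_eq; lra).
  assert (H0 : 0 <= tree x).
  { apply PSeries_nonneg; [apply tree_coef_pos|lra|].
    apply CV_radius_inside, CV_radius_below_tree; [apply Rabs_tree_coef_le|exact Hx2]. }
  split; [exact H0|].
  assert (H1 := tree_eq_exp x Hx). assert (H2 := exp_pos (tree x)).
  assert (O := tree_ode x Hx2). fold (tree x) in O.
  assert (H3 : 0 <= PSeries (PS_derive tree_coef) x).
  { apply PSeries_nonneg; [|lra|].
    - intros n. apply Rmult_le_pos; [apply pos_INR|apply tree_coef_pos].
    - apply ex_pseries_derive, CV_radius_below_tree;
        [apply Rabs_tree_coef_le|exact Hx2]. }
  destruct (proj1 Hx) as [Hx0|Hx0].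
  - assert (0 < tree x) by (rewrite H1; nra).
    destruct (Rlt_or_le (tree x) 1) as [|Hc]; [assumption|]. exfalso.
    assert (0 <= x * PSeries (PS_derive tree_coef) x) by nra. nra.
  - subst x. rewrite tree_0. lra.
Qed.

Lemma mul_exp_opp_lt (u : R) : 0 <= u < 1 -> 0 <= u * exp (- u) < exp (-1).
Proof.
  intros Hu. assert (H := exp_pos (-u)). split; [nra|].
  assert (H1 := exp_ineq1 (u - 1)). assert (H2 : u < exp (u - 1)) by lra.
  replace (exp (-1)) with (exp (u - 1) * exp (- u)) by (rewrite <- exp_plus; f_equal; ring).
  nra.
Qed.

(** Both u and tree (u exp (-u)) are solutions below 1 of the same equation f
    exp (-f) = q, and the strict inequality 1 + d < exp d makes that solution
    unique. *)
Lemma tree_mul_exp_opp (u : R) : 0 <= u < 1 -> tree (u * exp (- u)) = u.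
Proof.
  intros Hu. assert (Hq := mul_exp_opp_lt u Hu).
  assert (H1 := tree_lt_1 _ Hq). assert (H2 := tree_eq_exp _ Hq).
  set (f := tree (u * exp (- u))) in *.
  assert (E : f = u * exp (f - u)).
  { rewrite H2 at 1. unfold Rminus. rewrite exp_plus. ring. }
  assert (E' : f * exp (u - f) = u).
  { rewrite E at 1. rewrite Rmult_assoc, <- exp_plus.
    replace (f - u + (u - f)) with 0 by ring. rewrite exp_0. ring. }
  destruct (Rtotal_order f u) as [H|[H|H]]; [|exact H|]; exfalso.
  - assert (H3 := exp_ineq1 (f - u)). assert (1 + (f - u) < exp (f - u)) by lra. nra.
  - assert (H3 := exp_ineq1 (u - f)). assert (1 + (u - f) < exp (u - f)) by lra. nra.
Qed.

(** (m - 1)(m - 2) ... (m - i) / m^i, the factor that turns the coefficients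
    of tree into those of tree^(i+1) / (i+1). *)
Fixpoint fall_ratio (i m : nat) : R :=
  match i with
  | O => 1
  | S j => fall_ratio j m * (1 - INR (S j) / INR m)
  end.

Lemma fall_ratio_S (i m : nat) :
  fall_ratio (S i) m = fall_ratio i m * (1 - INR (S i) / INR m).
Proof. reflexivity. Qed.

Lemma fall_ratio_eq_0 (i m : nat) : (1 <= m <= i)%nat -> fall_ratio i m = 0.
Proof.
  intros Hm. induction i as [|i IH]; [lia|]. rewrite fall_ratio_S.
  destruct (Nat.eq_dec m (S i)) as [->|H].
  - assert (H : 0 < INR (S i)) by (apply lt_0_INR; lia). field. lra.
  - rewrite IH by lia. ring.
Qed.

Lemma fall_ratio_bounds (i m : nat) : (1 <= m)%nat -> 0 <= fall_ratio i m <= 1.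
Proof.
  intros Hm. assert (Hm' : 0 < INR m) by (apply lt_0_INR; lia).
  induction i as [|i IH]; [simpl; lra|].
  destruct (Nat.le_gt_cases m (S i)) as [H|H].
  - rewrite fall_ratio_eq_0 by lia. lra.
  - rewrite fall_ratio_S.
    assert (Hi : INR (S i) <= INR m) by (apply le_INR; lia).
    assert (Hi' := pos_INR (S i)).
    assert (Hd : 0 <= INR (S i) / INR m <= 1).
    { split; [apply Rdiv_le_0_compat; lra|].
      apply Rmult_le_reg_r with (INR m); [exact Hm'|]. field_simplify; lra. }
    nra.
Qed.

Lemma Rabs_tree_fall_le (i n : nat) :
  Rabs (tree_coef n * fall_ratio i n) <= tree_coef n.
Proof.
  destruct n as [|n].
  - simpl. rewrite Rmult_0_l, Rabs_R0. lra.
  - assert (H := fall_ratio_bounds i (S n) ltac:(lia)).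
    assert (H' := tree_coef_pos (S n)).
    rewrite Rabs_pos_eq; nra.
Qed.

(** Write f_i for the series. As m fall_ratio (i+1) m = (m - i - 1) fall_ratio
    i m, one gets x f_(i+1)' = x f_i' - (i+1) f_i. By induction this is tree^i
    (x tree' - tree), and tree_ode turns it into x tree^(i+1) tree'. *)
Lemma tree_pow_series (i : nat) (x : R) : 0 <= x < exp (-1) ->
  PSeries (fun n => tree_coef n * fall_ratio i n) x = tree x ^ S i / INR (S i).
Proof.
  revert x. induction i as [|i IH]; intros x Hx.
  - rewrite (PSeries_ext _ tree_coef) by (intros n; simpl; ring).
    simpl. unfold tree. field.
  - set (a := fun j n => tree_coef n * fall_ratio j n).
    assert (Hab : forall z, 0 <= z < exp (-1) -> Rabs z < exp (-1))
      by (intros z Hz; rewrite Rabs_pos_eq; lra).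
    assert (HS : forall j, 0 < INR (S j)) by (intros j; apply lt_0_INR; lia).
    assert (Df : forall z, 0 <= z < exp (-1) ->
       is_derive tree z (PSeries (PS_derive tree_coef) z)).
    { intros z Hz. apply is_derive_below_tree; [apply Rabs_tree_coef_le|apply Hab, Hz]. }
    assert (Dpow : forall j z, 0 <= z < exp (-1) ->
       is_derive (fun z => tree z ^ S j / INR (S j)) z
         (tree z ^ j * PSeries (PS_derive tree_coef) z)).
    { intros j z Hz.
      replace (tree z ^ j * PSeries (PS_derive tree_coef) z)
        with (scal (PSeries (PS_derive tree_coef) z) (tree z ^ j))
        by (unfold scal; simpl; unfold mult; simpl; ring).
      apply (is_derive_comp (fun y => y ^ S j / INR (S j)) tree); [|apply Df, Hz].
      assert (H := HS j). set (c := INR (S j)) in *.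
      auto_derive; [easy|].
      change (match j with O => 1 | S _ => INR j + 1 end) with c.
      change (Nat.pred (S j)) with j. field. lra. }
    assert (Da : forall j z, 0 <= z < exp (-1) ->
       is_derive (PSeries (a j)) z (PSeries (PS_derive (a j)) z)).
    { intros j z Hz. apply is_derive_below_tree;
        [intros n; apply Rabs_tree_fall_le|apply Hab, Hz]. }
    assert (E0 : PSeries (a (S i)) 0 - tree 0 ^ S (S i) / INR (S (S i)) = 0).
    { rewrite PSeries_0, tree_0, pow_i by lia. unfold a. simpl tree_coef.
      unfold Rdiv. ring. }
    assert (E : PSeries (a (S i)) x - tree x ^ S (S i) / INR (S (S i)) = 0).
    { destruct (proj1 Hx) as [Hx0|Hx0]; [|subst x; exact E0].
      rewrite <- E0. symmetry.
      apply (eq_of_derive_0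
        (fun z => PSeries (a (S i)) z - tree z ^ S (S i) / INR (S (S i))) 0 x);
        [|exact Hx0].
      intros z Hz. assert (Hz1 : 0 <= z < exp (-1)) by lra.
      replace 0 with (PSeries (PS_derive (a (S i))) z
        - tree z ^ S i * PSeries (PS_derive tree_coef) z).
      - apply (is_derive_minus (PSeries (a (S i)))
          (fun z => tree z ^ S (S i) / INR (S (S i))));
          [apply Da, Hz1|apply Dpow, Hz1].
      - destruct (proj1 Hz) as [Hz0|Hz0].
        + assert (F1 : z * PSeries (PS_derive (a (S i))) z
              = z * PSeries (PS_derive (a i)) z - INR (S i) * PSeries (a i) z).
          { rewrite !PSeries_mul_derive, <- PSeries_scal.
            rewrite <- PSeries_minus.
            - apply PSeries_ext. intros n. unfold PS_minus, PS_plus, PS_opp, PS_scal, a.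
              unfold plus, opp, scal; simpl; unfold mult; simpl.
              change (match i with O => 1 | S _ => INR i + 1 end) with (INR (S i)).
              destruct n as [|n]; [simpl; ring|].
              field. apply Rgt_not_eq, HS.
            - apply ex_pseries_ext with (PS_incr_1 (PS_derive (a i))).
              + intros [|n]; [|reflexivity]. simpl. unfold zero; simpl. ring.
              + apply CV_radius_inside. rewrite CV_radius_incr_1, CV_radius_derive.
                apply CV_radius_below_tree;
                  [intros n; apply Rabs_tree_fall_le|apply Hab, Hz1].
            - apply ex_pseries_scal; [apply Rmult_comm|].
              apply CV_radius_inside, CV_radius_below_tree;
                [intros n; apply Rabs_tree_fall_le|apply Hab, Hz1]. }
          assert (F2 : PSeries (PS_derive (a i)) z
              = tree z ^ i * PSeries (PS_derive tree_coef) z).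
          { transitivity (Derive (PSeries (a i)) z);
              [symmetry; apply is_derive_unique, Da, Hz1|].
            apply is_derive_unique.
            (* as z > 0, the induction hypothesis covers a full neighbourhood of z *)
            apply is_derive_ext_loc with (fun z => tree z ^ S i / INR (S i));
              [|apply Dpow, Hz1].
            assert (Hp : 0 < Rmin z (exp (-1) - z)) by (apply Rmin_pos; lra).
            exists (mkposreal _ Hp). intros w Hw.
            change (Rabs (w - z) < Rmin z (exp (-1) - z)) in Hw.
            symmetry. apply IH.
            assert (H1 := Rmin_l z (exp (-1) - z)).
            assert (H2 := Rmin_r z (exp (-1) - z)).
            apply Rabs_def2 in Hw. lra. }
          assert (O := tree_ode z (Hab z Hz1)). fold (tree z) in O.
          rewrite F2 in F1. unfold a in F1 at 2. rewrite IH in F1 by exact Hz1.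
          apply Rmult_eq_reg_l with z; [|lra].
          rewrite Rmult_minus_distr_l, F1.
          replace (INR (S i) * (tree z ^ S i / INR (S i)))
            with (tree z ^ i * (z * PSeries (PS_derive tree_coef) z * (1 - tree z)))
            by (rewrite O; simpl pow; field; apply Rgt_not_eq, HS).
          simpl pow. ring.
        + subst z. rewrite PSeries_0, tree_0, (pow_i (S i)) by lia.
          unfold PS_derive, a. rewrite (fall_ratio_eq_0 (S i) 1) by lia. ring. }
    unfold a in E. lra.
Qed.


(** * The Borel distribution *)

(** The limit r -> 1 is elementary for nonnegative terms: each partial sum is
    at most L by continuity in r, and the full sum dominates every F r. *)
Lemma is_series_of_abel_limit (c : nat -> R) (L : R) (F : R -> R) :
  (forall n, 0 <= c n) ->
  (forall r, 0 <= r < 1 -> is_series (fun n => c n * r ^ n) (F r)) ->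
  (forall r, 0 <= r < 1 -> F r <= L) ->
  (forall eps, 0 < eps -> exists r, 0 <= r < 1 /\ L - eps < F r) ->
  is_series c L.
Proof.
  intros Hc HF HL Hlim.
  assert (Hpart : forall n, sum_n c n <= L).
  { intros n.
    assert (Hk : forall r, 0 <= r < 1 -> sum_n (fun k => c k * r ^ k) n <= L).
    { intros r Hr. apply Rle_trans with (F r); [|apply HL, Hr].
      assert (H1 : is_lim_seq (sum_n (fun k => c k * r ^ k)) (F r)) by apply HF, Hr.
      assert (H2 := is_lim_seq_incr_compare _ _ H1). apply H2.
      intros m. rewrite sum_Sn. unfold plus; simpl.
      assert (0 <= c (S m) * r ^ S m).
      { apply Rmult_le_pos; [apply Hc|apply pow_le, Hr]. }
      simpl pow in H. lra. }
    assert (H1 : is_lim_seq (fun j => sum_n (fun k => c k * (1 - / (INR j + 1)) ^ k) n)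
                   (sum_n c n)).
    { replace (sum_n c n) with (sum_n (fun k => c k * 1 ^ k) n)
        by (apply sum_n_R_ext; intros k _; rewrite pow1; apply Rmult_1_r).
      assert (Hj : is_lim_seq (fun j => 1 - / (INR j + 1)) 1).
      { replace (Finite 1) with (Finite (1 - 0)) by (f_equal; ring).
        apply is_lim_seq_minus'; [apply is_lim_seq_const|].
        apply is_lim_seq_ext with (fun j => / INR (S j)).
        - intros j. now rewrite S_INR.
        - apply (is_lim_seq_incr_1 (fun j => / INR j)).
          replace (Finite 0) with (Rbar_inv p_infty) by reflexivity.
          apply is_lim_seq_inv; [apply is_lim_seq_INR|discriminate]. }
      apply (is_lim_seq_continuous (fun r => sum_n (fun k => c k * r ^ k) n)); [|exact Hj].
      apply continuity_pt_filterlim.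
      apply (ex_derive_continuous (fun r => sum_n (fun k => c k * r ^ k) n)).
      exists (sum_n (fun k => c k * (INR k * 1 ^ pred k)) n).
      apply (is_derive_sum_n (fun k r => c k * r ^ k)). intros k _.
      auto_derive; [easy|].
      match goal with |- ?a = ?b => change (a = b :> R) end. ring. }
    apply (is_lim_seq_le _ _ (sum_n c n) L) with (2 := H1) (3 := is_lim_seq_const L).
    intros j. apply Hk.
    assert (H := pos_INR j). assert (0 < / (INR j + 1)) by (apply Rinv_0_lt_compat; lra).
    assert (/ (INR j + 1) <= 1).
    { rewrite <- Rinv_1 at 2. apply Rinv_le_contravar; lra. }
    lra. }
  assert (Hex : ex_series c).
  { destruct (ex_finite_lim_seq_incr (sum_n c) L) as [l Hl]; [|exact Hpart|].
    - intros n. rewrite sum_Sn. unfold plus; simpl. specialize (Hc (S n)). lra.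
    - exists l. exact Hl. }
  assert (Hs := Series_correct _ Hex).
  assert (H1 : Series c <= L).
  { apply (is_lim_seq_le (sum_n c) (fun _ => L) (Series c) L);
      [exact Hpart|exact Hs|apply is_lim_seq_const]. }
  assert (H2 : L <= Series c).
  { apply Rnot_lt_le. intros Hlt.
    destruct (Hlim (L - Series c)) as [r [Hr Hr2]]; [lra|].
    assert (F r <= Series c); [|lra].
    rewrite <- (is_series_unique _ _ (HF r Hr)). apply Series_le; [|exact Hex].
    intros n. assert (0 <= r ^ n) by apply pow_le, Hr.
    assert (r ^ n <= 1) by (rewrite <- (pow1 n); apply pow_incr; lra).
    specialize (Hc n). split; nra. }
  replace L with (Series c) by lra. exact Hs.
Qed.

Lemma borel_fall_series (i : nat) :
  is_series (fun n => tree_coef n * fall_ratio i n * exp (-1) ^ n) (/ INR (S i)).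
Proof.
  assert (HS : 0 < INR (S i)) by (apply lt_0_INR; lia).
  assert (He := exp_pos (-1)).
  assert (Hx : forall r, 0 <= r < 1 -> 0 <= r * exp (-1) < exp (-1)).
  { intros r Hr. split; nra. }
  apply is_series_of_abel_limit with (fun r => tree (r * exp (-1)) ^ S i / INR (S i)).
  - intros n. apply Rmult_le_pos; [|apply pow_le; lra].
    destruct n as [|n]; [simpl; lra|].
    apply Rmult_le_pos; [apply tree_coef_pos|apply fall_ratio_bounds; lia].
  - intros r Hr. rewrite <- tree_pow_series by apply Hx, Hr.
    apply is_series_R_ext with
      (fun n => (tree_coef n * fall_ratio i n) * (r * exp (-1)) ^ n).
    + intros n. rewrite Rpow_mult_distr. ring.
    + apply is_pseries_R, PSeries_correct, CV_radius_inside, CV_radius_below_tree;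
        [intros n; apply Rabs_tree_fall_le|].
      rewrite Rabs_pos_eq; apply Hx, Hr.
  - intros r Hr. assert (H := tree_lt_1 _ (Hx r Hr)).
    assert (H1 : tree (r * exp (-1)) ^ S i <= 1)
      by (rewrite <- (pow1 (S i)); apply pow_incr; lra).
    unfold Rdiv. rewrite <- (Rmult_1_l (/ INR (S i))) at 2.
    apply Rmult_le_compat_r; [left; apply Rinv_0_lt_compat, HS|exact H1].
  - intros eps Heps.
    set (d := Rmin eps 1 / 2).
    assert (Hd : 0 < d < 1 /\ d < eps).
    { unfold d. assert (H1 := Rmin_l eps 1). assert (H2 := Rmin_r eps 1).
      assert (0 < Rmin eps 1) by (apply Rmin_pos; lra). lra. }
    (* this r makes the argument of tree equal to u exp (-u) with u = 1 - d *)
    exists ((1 - d) * exp d).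
    assert (E : (1 - d) * exp d * exp (-1) = (1 - d) * exp (- (1 - d))).
    { rewrite Rmult_assoc, <- exp_plus. do 2 f_equal. ring. }
    rewrite E, tree_mul_exp_opp by lra.
    assert (Hq := mul_exp_opp_lt (1 - d) ltac:(lra)). rewrite <- E in Hq.
    split; [split; nra|].
    assert (Hb : 1 - INR (S i) * d <= (1 - d) ^ S i).
    { assert (G : forall j, 1 - INR j * d <= (1 - d) ^ j).
      { induction j as [|j IH]; [simpl; lra|]. rewrite S_INR. simpl pow.
        assert (0 <= (1 - d) ^ j) by (apply pow_le; lra).
        assert (0 <= INR j) by apply pos_INR.
        assert (0 <= INR j * d) by (apply Rmult_le_pos; lra).
        assert ((1 - d) * (1 - INR j * d) <= (1 - d) * (1 - d) ^ j)
          by (apply Rmult_le_compat_l; lra). nra. }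
      apply G. }
    apply Rlt_le_trans with ((1 - INR (S i) * d) / INR (S i)).
    + unfold Rdiv. rewrite Rmult_minus_distr_r.
      replace (INR (S i) * d * / INR (S i)) with d by (field; lra). lra.
    + apply Rmult_le_compat_r; [left; apply Rinv_0_lt_compat, HS|exact Hb].
Qed.

(** The Borel distribution of parameter 1 (total progeny of a critical Poisson
    branching process), indexed by m = k + 1. *)
Definition borel (k : nat) : R :=
  INR (S k) ^ k / INR (fact (S k)) * exp (- INR (S k)).

Lemma borel_pos (k : nat) : 0 < borel k.
Proof.
  unfold borel. apply Rmult_lt_0_compat; [|apply exp_pos].
  apply Rdiv_lt_0_compat; [|apply INR_fact_pos].
  apply pow_lt, lt_0_INR. lia.
Qed.

(** The arithmetic heart of the proof. It is tree^(i+1) / (i+1) at the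
    boundary point 1/e, where tree equals 1. For i = 0 it says that the Borel
    weights sum to 1. *)
Lemma borel_mean_fall_ratio (i : nat) :
  is_series (fun k => borel k * fall_ratio i (S k)) (/ INR (S i)).
Proof.
  assert (H := is_series_incr_1
    (fun n => tree_coef n * fall_ratio i n * exp (-1) ^ n) (/ INR (S i))).
  eapply is_series_R_ext; [|apply H].
  - intros k. cbv beta. unfold borel.
    rewrite tree_coef_S, <- exp_INR_pow.
    replace (INR (S k) * -1) with (- INR (S k)) by ring. ring.
  - unfold plus. simpl tree_coef. rewrite !Rmult_0_l, Rplus_0_r.
    apply borel_fall_series.
Qed.

(** * Eigenfunctions *)

(** The eigenfunctions of the generator, normalised by the value 1 at n = 0,
    as polynomials in x = eigenvalue + 1; their three-term recurrence is the
    eigenvalue equation. *)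
Fixpoint spectral_poly (rho : R) (n : nat) (x : R) : R :=
  match n with
  | O => 1
  | S j => (((INR j + 1) * x + rho) * spectral_poly rho j x
            - INR j * spectral_poly rho (pred j) x) / rho
  end.

Lemma spectral_poly_S (rho : R) (n : nat) (x : R) : 0 < rho ->
  (INR n + 1) * (x * spectral_poly rho n x)
  = INR n * spectral_poly rho (pred n) x - rho * spectral_poly rho n x
    + rho * spectral_poly rho (S n) x.
Proof.
  intros Hr.
  change (spectral_poly rho (S n) x) with
   ((((INR n + 1) * x + rho) * spectral_poly rho n x
            - INR n * spectral_poly rho (pred n) x) / rho).
  field. lra.
Qed.

Lemma gbinom_S (a : R) (k : nat) :
  INR (S k) * gbinom a (S k) = (a - INR k) * gbinom a k.
Proof.
  change (gbinom a (S k)) with (gbinom a k * (a - INR k) / INR (S k)).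
  field. apply Rgt_not_eq, lt_0_INR. lia.
Qed.

Lemma pow_over_fact_S (z : R) (k : nat) :
  INR (S k) * (z ^ S k / INR (fact (S k))) = z * (z ^ k / INR (fact k)).
Proof.
  rewrite INR_fact_S, S_INR, <- tech_pow_Rmult.
  assert (H1 := INR_fact_pos k). assert (H2 := pos_INR k). field. lra.
Qed.

(** With a = n + alpha fixed, the Laguerre polynomials are the coefficients of
    F(w) = (1 + w)^a exp (-z w), and the recurrence is (1 + w) F' = (a - z (1
    + w)) F. *)
Lemma laguerre_rec (n : nat) (a z : R) :
  INR (S n) * laguerre (S n) (a - INR (S n)) z
  = (a - INR n - z) * laguerre n (a - INR n) z
    - z * match n with O => 0 | S j => laguerre j (a - INR j) z end.
Proof.
  set (h := fun k => (- z) ^ k / INR (fact k)).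
  assert (L : forall j, laguerre j (a - INR j) z
     = sum_n (fun k => gbinom a (j - k) * h k) j).
  { intros j. unfold laguerre. rewrite sum_n_Reals. apply sum_eq. intros k Hk.
    now replace (INR j + (a - INR j)) with a by ring. }
  assert (Hh : forall k, INR (S k) * h (S k) = - z * h k)
    by (intros k; apply pow_over_fact_S).
  (* the sum with an extra weight k drops the degree by one *)
  assert (Lk : sum_n (fun k => INR k * (gbinom a (n - k) * h k)) n
     = - z * match n with O => 0 | S j => laguerre j (a - INR j) z end :> R).
  { destruct n as [|j].
    - rewrite sum_O. simpl. ring.
    - rewrite sum_n_R_shift, L. simpl (INR 0). rewrite Rmult_0_l, Rplus_0_l.
      rewrite <- sum_n_R_scal. apply sum_n_R_ext. intros k Hk.
      replace (S j - S k)%nat with (j - k)%nat by lia.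
      transitivity (gbinom a (j - k) * (INR (S k) * h (S k))); [ring|].
      rewrite Hh. ring. }
  transitivity (sum_n (fun k => (a - INR (n - k)) * (gbinom a (n - k) * h k)) n
      + - z * laguerre n (a - INR n) z).
  - rewrite !L. rewrite <- sum_n_R_scal.
    transitivity (sum_n (fun k => INR (S n - k) * gbinom a (S n - k) * h k) (S n)
       + sum_n (fun k => gbinom a (S n - k) * (INR k * h k)) (S n)).
    + rewrite <- sum_n_R_plus. apply sum_n_R_ext. intros k Hk.
      rewrite minus_INR by lia. ring.
    + f_equal.
      * rewrite sum_Sn, Nat.sub_diag. unfold plus; simpl (_ + _).
        simpl (INR 0). rewrite !Rmult_0_l, Rplus_0_r.
        apply sum_n_R_ext. intros k Hk.
        replace (S n - k)%nat with (S (n - k)) by lia. rewrite gbinom_S. ring.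
      * rewrite sum_n_R_shift. simpl (INR 0). rewrite Rmult_0_l, Rmult_0_r, Rplus_0_l.
        rewrite <- sum_n_R_scal. apply sum_n_R_ext. intros k Hk.
        rewrite Hh. simpl (S n - S k)%nat. ring.
  - rewrite (L n).
    transitivity ((a - INR n) * sum_n (fun k => gbinom a (n - k) * h k) n
       + sum_n (fun k => INR k * (gbinom a (n - k) * h k)) n
       + - z * sum_n (fun k => gbinom a (n - k) * h k) n).
    + f_equal. rewrite <- sum_n_R_scal, <- sum_n_R_plus. apply sum_n_R_ext.
      intros k Hk. rewrite minus_INR by lia. ring.
    + rewrite Lk. ring.
Qed.

(** The quadratic equation of x = v + 1 gives rho / x - m x = rho, which is
    what turns the Laguerre recurrence into that of the eigenfunctions. *)
Lemma phi_eq_spectral_poly (rho : R) (m n : nat) (v : R) :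
  0 < rho -> v + 1 <> 0 -> INR m * (v + 1) ^ 2 + rho * (v + 1) - rho = 0 ->
  phi rho m n v = spectral_poly rho n (v + 1).
Proof.
  intros Hr Hx Hm. set (x := v + 1) in *.
  set (s := x / - rho). set (z := rho / x ^ 2). set (a := INR m - 1).
  assert (P : forall j, phi rho m j v = INR (fact j) * s ^ j * laguerre j (a - INR j) z)
    by reflexivity.
  assert (Hs : forall j, rho * (s * (a - INR j - z)) = (INR j + 1) * x + rho).
  { intros j. unfold s, z, a.
    replace (INR m) with (rho * (1 - x) / x ^ 2)
      by (apply Rmult_eq_reg_r with (x ^ 2); [|now apply pow_nonzero];
          field_simplify; [lra|exact Hx]).
    field. lra. }
  assert (Hz : rho * (s * (s * z)) = 1) by (unfold s, z; field; lra).
  assert (Hrec : forall j, rho * phi rho m (S j) v =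
     ((INR j + 1) * x + rho) * phi rho m j v - INR j * phi rho m (pred j) v).
  { intros j. rewrite (P (S j)), INR_fact_S.
    assert (E := laguerre_rec j a z). rewrite S_INR in E at 1.
    transitivity (rho * (INR (fact j) * s ^ S j) *
       ((INR j + 1) * laguerre (S j) (a - INR (S j)) z)); [ring|].
    rewrite E, <- Hs. destruct j as [|j].
    - rewrite P. simpl. ring.
    - simpl pred. rewrite (P (S j)), (P j), INR_fact_S, (S_INR j).
      rewrite <- !tech_pow_Rmult.
      transitivity (rho * (s * (a - (INR j + 1) - z)) *
         ((INR j + 1) * INR (fact j) * (s * s ^ j) * laguerre (S j) (a - (INR j + 1)) z)
         - rho * (s * (s * z)) * ((INR j + 1) *
           (INR (fact j) * s ^ j * laguerre j (a - INR j) z))); [ring|].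
      rewrite Hz. ring. }
  assert (Hstep : forall j, phi rho m j v = spectral_poly rho j x ->
     phi rho m (pred j) v = spectral_poly rho (pred j) x ->
     phi rho m (S j) v = spectral_poly rho (S j) x).
  { intros j H1 H2. simpl spectral_poly. rewrite <- H1, <- H2, <- Hrec. field. lra. }
  assert (H0 : phi rho m 0 v = spectral_poly rho 0 x).
  { rewrite P. unfold laguerre. simpl. field. }
  assert (R : phi rho m n v = spectral_poly rho n x /\
              phi rho m (S n) v = spectral_poly rho (S n) x); [|apply R].
  induction n as [|n [IH1 IH2]].
  - split; [exact H0|]. apply Hstep; exact H0.
  - split; [exact IH2|]. apply Hstep; [exact IH2|exact IH1].
Qed.

(** * Eigenvalues and the spectral measure *)

Lemma INR_S_ge_1 (k : nat) : 1 <= INR (S k).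
Proof. rewrite S_INR. assert (H := pos_INR k). lra. Qed.

Lemma nu_root (rho : R) (k : nat) : 0 < rho ->
  0 < nu rho (S k) + 1 < 1 /\
  INR (S k) * (nu rho (S k) + 1) ^ 2 + rho * (nu rho (S k) + 1) - rho = 0.
Proof.
  intros Hr. unfold nu. assert (Hm := INR_S_ge_1 k). set (m := INR (S k)) in *.
  assert (Hs : 0 <= rho ^ 2 + 4 * m * rho) by nra.
  assert (E := sqrt_sqrt _ Hs). assert (E0 := sqrt_pos (rho ^ 2 + 4 * m * rho)).
  set (r := sqrt (rho ^ 2 + 4 * m * rho)) in *.
  replace (-1 + 1 / (2 * m) * (- rho + r) + 1) with ((r - rho) / (2 * m)) by (field; lra).
  assert (H1 : rho < r) by nra. assert (H2 : r < rho + 2 * m) by nra.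
  split; [split|].
  - apply Rdiv_lt_0_compat; lra.
  - apply Rmult_lt_reg_r with (2 * m); [lra|]. field_simplify; lra.
  - replace (m * ((r - rho) / (2 * m)) ^ 2 + rho * ((r - rho) / (2 * m)) - rho)
      with ((r * r - rho ^ 2 - 4 * m * rho) / (4 * m)) by (field; lra).
    rewrite E. field. lra.
Qed.

Lemma nu_tilde_root (rho : R) (k : nat) : 0 < rho ->
  - (1 + rho) <= nu_tilde rho (S k) + 1 < 0 /\
  INR (S k) * (nu_tilde rho (S k) + 1) ^ 2
    + rho * (nu_tilde rho (S k) + 1) - rho = 0.
Proof.
  intros Hr. unfold nu_tilde. assert (Hm := INR_S_ge_1 k). set (m := INR (S k)) in *.
  assert (Hs : 0 <= rho ^ 2 + 4 * m * rho) by nra.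
  assert (E := sqrt_sqrt _ Hs). assert (E0 := sqrt_pos (rho ^ 2 + 4 * m * rho)).
  set (r := sqrt (rho ^ 2 + 4 * m * rho)) in *.
  replace (-1 + 1 / (2 * m) * (- rho - r) + 1) with (- (r + rho) / (2 * m)) by (field; lra).
  assert (H1 : rho < r) by nra. assert (H2 : r < rho + 2 * m) by nra.
  split; [split|].
  - apply Rmult_le_reg_r with (2 * m); [lra|]. field_simplify; nra.
  - apply Rmult_lt_reg_r with (2 * m); [lra|]. field_simplify; lra.
  - replace (m * (- (r + rho) / (2 * m)) ^ 2 + rho * (- (r + rho) / (2 * m)) - rho)
      with ((r * r - rho ^ 2 - 4 * m * rho) / (4 * m)) by (field; lra).
    rewrite E. field. lra.
Qed.

(** The two roots have the same sum and product -rho / m. *)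
Lemma nu_tilde_of_nu (rho : R) (k : nat) : 0 < rho ->
  nu_tilde rho (S k) + 1 = (nu rho (S k) + 1) / (nu rho (S k) + 1 - 1).
Proof.
  intros Hr. destruct (nu_root rho k Hr) as [Hx _].
  destruct (nu_tilde_root rho k Hr) as [Hy Ey].
  assert (Hm := INR_S_ge_1 k).
  assert (Hsum : INR (S k) * ((nu rho (S k) + 1) + (nu_tilde rho (S k) + 1)) = - rho).
  { unfold nu, nu_tilde. field. lra. }
  set (x := nu rho (S k) + 1) in *. set (y := nu_tilde rho (S k) + 1) in *.
  set (m := INR (S k)) in *.
  assert (H : m * (y * (x - 1) - x) = 0).
  { nra. }
  apply Rmult_integral in H. destruct H as [H|H]; [lra|].
  apply Rmult_eq_reg_r with (x - 1); [|lra]. field_simplify; lra.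
Qed.

Lemma Ccoef_borel (k : nat) (v : R) : Ccoef (S k) v = borel k * (v / (v - 1)).
Proof.
  unfold Ccoef, borel. rewrite Nat.sub_succ, Nat.sub_0_r. ring.
Qed.

Lemma Ccoef_bounds (k : nat) (v : R) : v < 0 -> 0 <= Ccoef (S k) v <= borel k.
Proof.
  intros Hv. rewrite Ccoef_borel. assert (Hb := borel_pos k).
  assert (0 <= v / (v - 1) <= 1); [|nra].
  replace (v / (v - 1)) with (- v / (1 - v)) by (field; lra).
  split; [apply Rdiv_le_0_compat; lra|].
  apply Rmult_le_reg_r with (1 - v); [lra|]. field_simplify; lra.
Qed.

(** An interval that contains all eigenvalues, shifted by 1, for every m.
    Excluding 1 keeps 1 - x z positive for 0 < z < 1. *)
Definition in_spectrum (rho x : R) : Prop := - (1 + rho) <= x < 1.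

Definition bounded_on_spectrum (rho : R) (g : R -> R) : Prop :=
  exists M, forall x, in_spectrum rho x -> Rabs (g x) <= M.

Definition spectral_pair (rho : R) (g : R -> R) (k : nat) : R :=
  Ccoef (S k) (nu rho (S k)) * g (nu rho (S k) + 1)
  + Ccoef (S k) (nu_tilde rho (S k)) * g (nu_tilde rho (S k) + 1).

(** Integration against the spectral measure, a probability measure on the
    shifted eigenvalues. *)
Definition spectral_mean (rho : R) (g : R -> R) : R := Series (spectral_pair rho g).

Lemma nu_in_spectrum (rho : R) (k : nat) : 0 < rho -> in_spectrum rho (nu rho (S k) + 1).
Proof. intros Hr. destruct (nu_root rho k Hr). unfold in_spectrum. lra. Qed.

Lemma nu_tilde_in_spectrum (rho : R) (k : nat) :
  0 < rho -> in_spectrum rho (nu_tilde rho (S k) + 1).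
Proof. intros Hr. destruct (nu_tilde_root rho k Hr). unfold in_spectrum. lra. Qed.

Lemma borel_series : is_series borel 1.
Proof.
  replace 1 with (/ INR 1) by (simpl; field).
  eapply is_series_R_ext; [|apply borel_mean_fall_ratio].
  intros k. simpl fall_ratio. apply Rmult_1_r.
Qed.

Lemma ex_series_borel_mul (g : nat -> R) (M : R) :
  (forall k, Rabs (g k) <= M * borel k) -> ex_series g.
Proof.
  intros Hg. apply (ex_series_le g (fun k => M * borel k)); [exact Hg|].
  apply ex_series_R_scal. exists 1. exact borel_series.
Qed.

Lemma ex_series_spectral (rho : R) (g : R -> R) : 0 < rho ->
  bounded_on_spectrum rho g ->
  ex_series (fun k => Ccoef (S k) (nu rho (S k)) * g (nu rho (S k) + 1)) /\
  ex_series (fun k => Ccoef (S k) (nu_tilde rho (S k)) * g (nu_tilde rho (S k) + 1)).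
Proof.
  intros Hr [M HM].
  split; apply ex_series_borel_mul with M; intros k; rewrite Rabs_mult.
  - assert (H := nu_in_spectrum rho k Hr). assert (H1 := HM _ H). unfold in_spectrum in H.
    assert (H2 := Ccoef_bounds k (nu rho (S k)) ltac:(lra)).
    rewrite (Rabs_pos_eq (Ccoef _ _)) by lra.
    rewrite Rmult_comm. apply Rmult_le_compat; try lra; apply Rabs_pos.
  - assert (H := nu_tilde_in_spectrum rho k Hr). assert (H1 := HM _ H).
    unfold in_spectrum in H.
    assert (H2 := Ccoef_bounds k (nu_tilde rho (S k)) ltac:(lra)).
    rewrite (Rabs_pos_eq (Ccoef _ _)) by lra.
    rewrite Rmult_comm. apply Rmult_le_compat; try lra; apply Rabs_pos.
Qed.

Lemma ex_series_spectral_pair (rho : R) (g : R -> R) : 0 < rho ->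
  bounded_on_spectrum rho g -> ex_series (spectral_pair rho g).
Proof.
  intros Hr Hg. destruct (ex_series_spectral rho g Hr Hg) as [H1 H2].
  exact (ex_series_plus _ _ H1 H2).
Qed.

Lemma spectral_mean_ext (rho : R) (f g : R -> R) : 0 < rho ->
  (forall x, in_spectrum rho x -> f x = g x) ->
  spectral_mean rho f = spectral_mean rho g.
Proof.
  intros Hr H. apply Series_ext. intros k. unfold spectral_pair.
  rewrite !H; [reflexivity|now apply nu_tilde_in_spectrum|now apply nu_in_spectrum].
Qed.

Lemma spectral_mean_plus (rho : R) (f g : R -> R) : 0 < rho ->
  bounded_on_spectrum rho f -> bounded_on_spectrum rho g ->
  spectral_mean rho (fun x => f x + g x) = spectral_mean rho f + spectral_mean rho g.
Proof.
  intros Hr Hf Hg. unfold spectral_mean.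
  rewrite <- Series_plus by now apply ex_series_spectral_pair.
  apply Series_ext. intros k. unfold spectral_pair. ring.
Qed.

Lemma spectral_mean_scal (rho c : R) (f : R -> R) :
  spectral_mean rho (fun x => c * f x) = c * spectral_mean rho f.
Proof.
  unfold spectral_mean. rewrite <- Series_scal_l.
  apply Series_ext. intros k. unfold spectral_pair. ring.
Qed.

Lemma bounded_plus (rho : R) (f g : R -> R) :
  bounded_on_spectrum rho f -> bounded_on_spectrum rho g ->
  bounded_on_spectrum rho (fun x => f x + g x).
Proof.
  intros [M HM] [N HN]. exists (M + N). intros x Hx.
  eapply Rle_trans; [apply Rabs_triang|]. apply Rplus_le_compat; auto.
Qed.

Lemma bounded_mult (rho : R) (f g : R -> R) :
  bounded_on_spectrum rho f -> bounded_on_spectrum rho g ->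
  bounded_on_spectrum rho (fun x => f x * g x).
Proof.
  intros [M HM] [N HN]. exists (M * N). intros x Hx. rewrite Rabs_mult.
  apply Rmult_le_compat; auto using Rabs_pos.
Qed.

Lemma bounded_const (rho c : R) : bounded_on_spectrum rho (fun _ => c).
Proof. exists (Rabs c). intros x _. lra. Qed.

Lemma bounded_id (rho : R) : bounded_on_spectrum rho (fun x => x).
Proof.
  exists (2 + Rabs rho). intros x [H1 H2]. assert (H := Rle_abs rho).
  assert (H' := Rabs_pos rho). apply Rabs_le. lra.
Qed.

Lemma bounded_pow (rho : R) (f : R -> R) (n : nat) :
  bounded_on_spectrum rho f -> bounded_on_spectrum rho (fun x => f x ^ n).
Proof.
  intros Hf. induction n as [|n IH]; [exact (bounded_const rho 1)|].
  exact (bounded_mult rho f _ Hf IH).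
Qed.

Lemma bounded_ext (rho : R) (f g : R -> R) :
  (forall x, g x = f x) -> bounded_on_spectrum rho f -> bounded_on_spectrum rho g.
Proof. intros E [M HM]. exists M. intros x Hx. rewrite E. auto. Qed.

Lemma bounded_spectral_poly (rho : R) (n : nat) :
  bounded_on_spectrum rho (spectral_poly rho n).
Proof.
  assert (H : bounded_on_spectrum rho (spectral_poly rho n) /\
              bounded_on_spectrum rho (spectral_poly rho (pred n))).
  { induction n as [|n [IH1 IH2]].
    - split; exact (bounded_const rho 1).
    - split; [|exact IH1].
      apply bounded_ext with (2 := bounded_mult rho _ _ (bounded_plus rho _ _
        (bounded_mult rho _ _ (bounded_plus rho _ _
          (bounded_mult rho _ _ (bounded_const rho (INR n + 1)) (bounded_id rho))
          (bounded_const rho rho)) IH1)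
        (bounded_mult rho _ _ (bounded_const rho (- INR n)) IH2))
        (bounded_const rho (/ rho))).
      intros x. simpl spectral_poly. unfold Rdiv. ring. }
  apply H.
Qed.

(** The two eigenvalues attached to m share the Borel weight of m. *)
Lemma Ccoef_pair_sum (rho : R) (k : nat) : 0 < rho ->
  Ccoef (S k) (nu rho (S k)) + Ccoef (S k) (nu_tilde rho (S k)) = borel k.
Proof.
  intros Hr. rewrite !Ccoef_borel.
  destruct (nu_root rho k Hr) as [Hx _].
  assert (E := nu_tilde_of_nu rho k Hr).
  replace (nu_tilde rho (S k)) with ((nu rho (S k) + 1) / (nu rho (S k) + 1 - 1) - 1)
    by lra.
  field. lra.
Qed.

(** The spectral weights are nonnegative and sum to 1. *)
Lemma spectral_mean_abs_le (rho : R) (g : R -> R) (M : R) : 0 < rho ->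
  (forall x, in_spectrum rho x -> Rabs (g x) <= M) ->
  Rabs (spectral_mean rho g) <= M.
Proof.
  intros Hr HM.
  assert (Hk : forall k, Rabs (spectral_pair rho g k) <= M * borel k).
  { intros k. unfold spectral_pair. rewrite <- (Ccoef_pair_sum rho k Hr).
    assert (H := nu_in_spectrum rho k Hr). assert (H1 := HM _ H).
    assert (H' := nu_tilde_in_spectrum rho k Hr). assert (H1' := HM _ H').
    unfold in_spectrum in *.
    assert (H2 := Ccoef_bounds k (nu rho (S k)) ltac:(lra)).
    assert (H2' := Ccoef_bounds k (nu_tilde rho (S k)) ltac:(lra)).
    eapply Rle_trans; [apply Rabs_triang|]. rewrite !Rabs_mult.
    rewrite (Rabs_pos_eq (Ccoef _ (nu _ _))), (Rabs_pos_eq (Ccoef _ (nu_tilde _ _))) by lra.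
    nra. }
  assert (Hb : ex_series (fun k => M * borel k)).
  { apply ex_series_R_scal. exists 1. exact borel_series. }
  unfold spectral_mean. eapply Rle_trans; [apply Series_Rabs|].
  - apply (ex_series_le (fun k => Rabs (spectral_pair rho g k)) (fun k => M * borel k));
      [|exact Hb].
    intros k. change (Rabs (Rabs (spectral_pair rho g k)) <= M * borel k).
    rewrite Rabs_Rabsolu. apply Hk.
  - eapply Rle_trans; [apply (Series_le _ (fun k => M * borel k))|].
    + intros k. split; [apply Rabs_pos|apply Hk].
    + exact Hb.
    + rewrite Series_scal_l, (is_series_unique _ _ borel_series). lra.
Qed.

(** * The resolvent and the normalisation *)

(** The Borel mean of fall_ratio i (M) M / (M + K). It equals the integral of
    u^i (u exp (1 - u))^K over [0, 1]. *)
Definition resolvent_moment (K : R) (i : nat) : R :=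
  Series (fun k => borel k * fall_ratio i (S k) * (INR (S k) / (INR (S k) + K))).

Lemma resolvent_moment_terms (K : R) (i k : nat) : 0 < K ->
  0 <= borel k * fall_ratio i (S k) * (INR (S k) / (INR (S k) + K)) <= borel k.
Proof.
  intros HK. assert (Hb := borel_pos k).
  assert (Hf := fall_ratio_bounds i (S k) ltac:(lia)). assert (Hm := INR_S_ge_1 k).
  assert (Hq : 0 <= INR (S k) / (INR (S k) + K) <= 1).
  { split; [apply Rdiv_le_0_compat; lra|].
    apply Rmult_le_reg_r with (INR (S k) + K); [lra|]. field_simplify; lra. }
  assert (0 <= borel k * fall_ratio i (S k) <= borel k) by nra. nra.
Qed.

Lemma ex_series_resolvent_moment (K : R) (i : nat) : 0 < K ->
  ex_series (fun k => borel k * fall_ratio i (S k) * (INR (S k) / (INR (S k) + K))).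
Proof.
  intros HK. apply ex_series_borel_mul with 1. intros k.
  assert (H := resolvent_moment_terms K i k HK). rewrite Rabs_pos_eq; lra.
Qed.

Lemma resolvent_moment_bounds (K : R) (i : nat) : 0 < K ->
  0 <= resolvent_moment K i <= 1.
Proof.
  intros HK. unfold resolvent_moment. split.
  - rewrite <- (Rmult_0_l (Series borel)), <- Series_scal_l.
    apply Series_le; [|now apply ex_series_resolvent_moment].
    intros k. assert (H := resolvent_moment_terms K i k HK). lra.
  - rewrite <- (is_series_unique _ _ borel_series).
    apply Series_le; [|exists 1; exact borel_series].
    intros k. now apply resolvent_moment_terms.
Qed.

(** Integrating the derivative of u^(i+1) (u exp (1 - u))^K over [0, 1]
    suggests this relation; on the series it is borel_mean_fall_ratio, because
    the factor M + K cancels. *)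
Lemma resolvent_moment_rec (K : R) (i : nat) : 0 < K ->
  (INR (S i) + K) * resolvent_moment K i - K * resolvent_moment K (S i) = 1.
Proof.
  intros HK. unfold resolvent_moment. rewrite <- !Series_scal_l.
  rewrite <- Series_minus by
    (apply ex_series_R_scal; now apply ex_series_resolvent_moment).
  assert (HS : 0 < INR (S i)) by (apply lt_0_INR; lia).
  replace 1 with (INR (S i) * / INR (S i)) by (field; lra).
  rewrite <- (is_series_unique _ _ (borel_mean_fall_ratio i)), <- Series_scal_l.
  apply Series_ext. intros k. rewrite fall_ratio_S.
  assert (Hm := INR_S_ge_1 k). field. lra.
Qed.

(** The integral of u^i (z + (1 - z) u)^n (u exp (1 - u))^K. For K = rho z (1
    - z) and i = 0 it is, up to a factor, the Laplace transform of the density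
    p_n, with z the inverse of the Laplace variable shifted by 1. *)
Fixpoint mixed_moment (K z : R) (n i : nat) : R :=
  match n with
  | O => resolvent_moment K i
  | S j => (1 - z) * mixed_moment K z j (S i) + z * mixed_moment K z j i
  end.

Lemma mixed_moment_bounds (K z : R) (n i : nat) : 0 < K -> 0 < z < 1 ->
  0 <= mixed_moment K z n i <= 1.
Proof.
  intros HK Hz. revert i. induction n as [|n IH]; intros i; simpl.
  - now apply resolvent_moment_bounds.
  - assert (H1 := IH i). assert (H2 := IH (S i)). nra.
Qed.

(** For i = 0 this is the Laplace transform of the equations of the queue.
    Carrying the exponent i along makes an induction on n possible: the
    relation for n + 1 at i is the combination, with weights 1 - z and z, of
    the relations for n at i + 1 and at i. *)
Lemma mixed_moment_rec (rho z : R) (n i : nat) : 0 < rho -> 0 < z < 1 ->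
  let W := mixed_moment (rho * z * (1 - z)) z in
  (INR n + INR i + 1) * W n i - INR n * z * W (pred n) i
    - rho * z * (W (S n) i - W n i) = 1.
Proof.
  intros Hr Hz W.
  assert (HK : 0 < rho * z * (1 - z)) by (repeat apply Rmult_lt_0_compat; lra).
  assert (HW : forall n i, W (S n) i = (1 - z) * W n (S i) + z * W n i) by reflexivity.
  revert i. induction n as [|n IH]; intros i.
  - assert (H := resolvent_moment_rec _ i HK).
    change (resolvent_moment (rho * z * (1 - z))) with (W 0%nat) in H.
    rewrite HW. rewrite S_INR in H. simpl INR. lra.
  - assert (H0 := IH i). assert (H1 := IH (S i)). rewrite S_INR in H1.
    rewrite S_INR. simpl pred.
    assert (Hp : INR n * W n i = INR n * ((1 - z) * W (pred n) (S i) + z * W (pred n) i)).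
    { destruct n as [|n]; [simpl; ring|]. simpl pred. now rewrite <- HW. }
    rewrite (HW (S n) i).
    rewrite (HW n i) in H0 |- *.
    rewrite (HW n (S i)) in H1 |- *.
    generalize dependent (W (pred n) i). generalize dependent (W (pred n) (S i)).
    generalize (W n (S (S i))). generalize (W n (S i)). generalize (W n i).
    intros a b c d Hd e H2 H3. nra.
Qed.

Lemma bounded_resolvent (rho z : R) : 0 < z < 1 ->
  bounded_on_spectrum rho (fun x => / (1 - x * z)).
Proof.
  intros Hz. exists (/ (1 - z)). intros x [_ Hx].
  assert (1 - z <= 1 - x * z) by nra.
  rewrite Rabs_pos_eq; [apply Rinv_le_contravar; lra|].
  left. apply Rinv_0_lt_compat. lra.
Qed.

(** For each m the two weighted values of 1 / (1 - x z) add up to the Borel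
    weight times the rational function m / (m + K). *)
Lemma spectral_mean_resolvent (rho z : R) : 0 < rho -> 0 < z < 1 ->
  spectral_mean rho (fun x => / (1 - x * z)) = resolvent_moment (rho * z * (1 - z)) 0.
Proof.
  intros Hr Hz. apply Series_ext. intros k. unfold spectral_pair.
  rewrite !Ccoef_borel. simpl fall_ratio.
  destruct (nu_root rho k Hr) as [Hx Ex].
  assert (E := nu_tilde_of_nu rho k Hr). set (x := nu rho (S k) + 1) in *.
  replace (nu_tilde rho (S k)) with (x / (x - 1) - 1) by lra.
  replace (nu rho (S k)) with (x - 1) by (unfold x; ring).
  replace (INR (S k)) with (rho * (1 - x) / x ^ 2)
    by (apply Rmult_eq_reg_r with (x ^ 2); [|apply pow_nonzero; lra];
        field_simplify; [lra|lra]).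
  assert (x * z < 1) by nra. assert (0 < x * z) by nra.
  assert (0 < rho * (1 - x)) by (apply Rmult_lt_0_compat; lra).
  assert (0 <= rho * z * (1 - z) * x ^ 2).
  { apply Rmult_le_pos; [|apply pow_le; lra].
    repeat apply Rmult_le_pos; lra. }
  field. repeat split; nra.
Qed.

(** The eigenvalue equation integrated against 1 / (1 - x z), using x z / (1 -
    x z) = 1 / (1 - x z) - 1. *)
Lemma resolvent_rec (rho z : R) (n : nat) : 0 < rho -> 0 < z < 1 ->
  let A j := spectral_mean rho (fun x => spectral_poly rho j x * / (1 - x * z)) in
  (INR n + 1) * (A n - spectral_mean rho (spectral_poly rho n))
  = z * (INR n * A (pred n) - rho * A n + rho * A (S n)).
Proof.
  intros Hr Hz A.
  assert (HB : forall j,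
    bounded_on_spectrum rho (fun x => spectral_poly rho j x * / (1 - x * z))).
  { intros j. apply bounded_mult;
      [apply bounded_spectral_poly|now apply bounded_resolvent]. }
  assert (Hc : forall c f, bounded_on_spectrum rho f ->
    bounded_on_spectrum rho (fun x => c * f x)).
  { intros c f Hf. apply bounded_mult; [apply bounded_const|exact Hf]. }
  assert (E : spectral_mean rho (fun x => z * rho *
      (spectral_poly rho (S n) x * / (1 - x * z)))
    = spectral_mean rho (fun x =>
       (INR n + 1 + z * rho) * (spectral_poly rho n x * / (1 - x * z))
       + (- (INR n + 1) * spectral_poly rho n x
          + - (z * INR n) * (spectral_poly rho (pred n) x * / (1 - x * z))))).
  { apply spectral_mean_ext; [exact Hr|]. intros x [_ Hx].
    assert (Hp : 0 < 1 - x * z) by nra.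
    assert (Q := spectral_poly_S rho n x Hr).
    apply Rmult_eq_reg_r with (1 - x * z); [|lra].
    transitivity (z * (rho * spectral_poly rho (S n) x)); [field; lra|].
    replace (rho * spectral_poly rho (S n) x) with
      ((INR n + 1) * (x * spectral_poly rho n x)
       - INR n * spectral_poly rho (pred n) x + rho * spectral_poly rho n x) by lra.
    field. lra. }
  rewrite spectral_mean_scal in E.
  rewrite spectral_mean_plus, spectral_mean_plus, !spectral_mean_scal in E; auto.
  - fold (A (S n)) (A n) (A (pred n)) in E.
    change (spectral_mean rho (fun x => spectral_poly rho n x))
      with (spectral_mean rho (spectral_poly rho n)) in E. lra.
  - apply Hc, bounded_spectral_poly.
  - apply bounded_plus; [apply Hc, bounded_spectral_poly|apply Hc, HB].
Qed.

Lemma eq_0_of_small (a c : R) :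
  (forall z, 0 < z <= / 2 -> Rabs a <= z * c) -> a = 0.
Proof.
  intros H. destruct (Req_dec a 0) as [|Ha]; [assumption|exfalso].
  assert (Hp := Rabs_pos_lt a Ha).
  assert (H1 := H (/ 2) ltac:(lra)). assert (Hc : 0 < c) by nra.
  assert (Hz : 0 < Rmin (/ 2) (Rabs a / (2 * c))).
  { apply Rmin_pos; [lra|]. apply Rdiv_lt_0_compat; lra. }
  assert (H2 := H _ (conj Hz (Rmin_l _ _))).
  assert (H3 := Rmin_r (/ 2) (Rabs a / (2 * c))).
  assert (Rmin (/ 2) (Rabs a / (2 * c)) * c <= Rabs a / (2 * c) * c)
    by (apply Rmult_le_compat_r; lra).
  replace (Rabs a / (2 * c) * c) with (Rabs a / 2) in H0 by (field; lra). lra.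
Qed.

(** The recurrences of A and of W differ only in the constant term: (n+1)
    times the spectral mean for A, 1 for W. The discrepancy equals z rho (W -
    A) at n + 1, which is bounded by a multiple of z, so it vanishes as z ->
    0. Equality of the constant terms then gives A = W at n + 1. *)
Lemma spectral_mean_poly_step (rho : R) (n : nat) : 0 < rho ->
  let A z j := spectral_mean rho (fun x => spectral_poly rho j x * / (1 - x * z)) in
  let W z j := mixed_moment (rho * z * (1 - z)) z j 0 in
  (forall z, 0 < z < 1 -> A z n = W z n /\ A z (pred n) = W z (pred n)) ->
  spectral_mean rho (spectral_poly rho n) = / (INR n + 1) /\
  forall z, 0 < z < 1 -> A z (S n) = W z (S n).
Proof.
  intros Hr A W IH. assert (Hn := pos_INR n).
  assert (D : forall z, 0 < z < 1 ->
    (INR n + 1) * spectral_mean rho (spectral_poly rho n) - 1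
    = z * (rho * (W z (S n) - A z (S n)))).
  { intros z Hz. assert (H1 := resolvent_rec rho z n Hr Hz). cbv beta zeta in H1.
    fold (A z n) (A z (pred n)) (A z (S n)) in H1.
    assert (H2 := mixed_moment_rec rho z n 0 Hr Hz). cbv beta zeta in H2.
    fold (W z n) (W z (pred n)) (W z (S n)) in H2. simpl (INR 0) in H2.
    destruct (IH z Hz) as [E1 E2]. rewrite E1, E2 in H1. lra. }
  assert (Z : (INR n + 1) * spectral_mean rho (spectral_poly rho n) - 1 = 0).
  { destruct (bounded_spectral_poly rho (S n)) as [M HM].
    apply eq_0_of_small with (rho * (1 + M * 2)). intros z Hz.
    rewrite (D z) by lra. rewrite Rabs_mult, (Rabs_pos_eq z) by lra.
    apply Rmult_le_compat_l; [lra|]. rewrite Rabs_mult, (Rabs_pos_eq rho) by lra.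
    apply Rmult_le_compat_l; [lra|].
    assert (HK : 0 < rho * z * (1 - z)) by (repeat apply Rmult_lt_0_compat; lra).
    assert (HW := mixed_moment_bounds _ z (S n) 0 HK ltac:(lra)). fold (W z (S n)) in HW.
    assert (HA : Rabs (A z (S n)) <= M * 2).
    { apply spectral_mean_abs_le; [exact Hr|]. intros x Hx. rewrite Rabs_mult.
      apply Rmult_le_compat; try apply Rabs_pos; [apply HM, Hx|].
      destruct Hx as [_ Hx]. assert (/ 2 <= 1 - x * z) by nra.
      rewrite Rabs_pos_eq by (left; apply Rinv_0_lt_compat; lra).
      rewrite <- (Rinv_inv 2). apply Rinv_le_contravar; lra. }
    unfold Rminus. eapply Rle_trans; [apply Rabs_triang|].
    rewrite Rabs_Ropp, (Rabs_pos_eq (W _ _)) by lra. lra. }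
  split.
  - apply Rmult_eq_reg_l with (INR n + 1); [|lra]. rewrite Rinv_r by lra. lra.
  - intros z Hz. assert (H := D z Hz). rewrite Z in H.
    symmetry in H. apply Rmult_integral in H. destruct H as [H|H]; [lra|].
    apply Rmult_integral in H. destruct H as [H|H]; lra.
Qed.

(** The normalisation at time 0: the claimed expansion has the value p_n(0).
    *)
Lemma spectral_mean_poly (rho : R) (n : nat) : 0 < rho ->
  spectral_mean rho (spectral_poly rho n) = / (INR n + 1).
Proof.
  intros Hr.
  assert (H0 : forall z, 0 < z < 1 ->
    spectral_mean rho (fun x => spectral_poly rho 0 x * / (1 - x * z))
    = mixed_moment (rho * z * (1 - z)) z 0 0).
  { intros z Hz. simpl mixed_moment. rewrite <- spectral_mean_resolvent by assumption.
    apply spectral_mean_ext; [exact Hr|]. intros x _. simpl. ring. }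
  assert (H : forall z, 0 < z < 1 ->
    spectral_mean rho (fun x => spectral_poly rho n x * / (1 - x * z))
    = mixed_moment (rho * z * (1 - z)) z n 0 /\
    spectral_mean rho (fun x => spectral_poly rho (pred n) x * / (1 - x * z))
    = mixed_moment (rho * z * (1 - z)) z (pred n) 0).
  { induction n as [|n IH]; intros z Hz.
    - split; now apply H0.
    - split; [|now apply IH]. now apply (spectral_mean_poly_step rho n Hr IH). }
  apply (spectral_mean_poly_step rho n Hr H).
Qed.

(** * Taylor remainders *)

Fixpoint taylor (c : nat -> R) (N : nat) (t : R) : R :=
  match N with
  | O => 0
  | S j => taylor c j t + c j * (t ^ j / INR (fact j))
  end.

Lemma taylor_0 (c : nat -> R) (N : nat) : taylor c (S N) 0 = c 0%nat.
Proof.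
  induction N as [|N IH]; [simpl; field|].
  change (taylor c (S N) 0 + c (S N) * (0 ^ S N / INR (fact (S N))) = c 0%nat).
  rewrite IH, pow_i by lia. unfold Rdiv. ring.
Qed.

Lemma is_derive_taylor (c : nat -> R) (N : nat) (t : R) :
  is_derive (taylor c (S N)) t (taylor (fun k => c (S k)) N t).
Proof.
  induction N as [|N IH].
  - simpl. auto_derive; [easy|ring].
  - apply (is_derive_plus (taylor c (S N)) (fun t => c (S N) * (t ^ S N / INR (fact (S N))))).
    + exact IH.
    + apply (is_derive_scal (fun t => t ^ S N / INR (fact (S N)))).
      apply is_derive_pow_fact0.
Qed.

Lemma taylor_ext (c d : nat -> R) (N : nat) (t : R) :
  (forall k, c k = d k) -> taylor c N t = taylor d N t.
Proof. intros H. induction N as [|N IH]; simpl; [easy|]. now rewrite IH, H. Qed.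

Lemma increment_bound (h dh : R -> R) (M t : R) (j : nat) :
  0 <= t ->
  (forall s, 0 < s -> is_derive h s (dh s)) -> continuity_pt h 0 ->
  (forall s, 0 <= s -> dh s <= M * (s ^ j / INR (fact j))) ->
  h t - h 0 <= M * (t ^ S j / INR (fact (S j))).
Proof.
  intros [Ht|Ht] Hd Hc Hb.
  2:{ subst t. rewrite pow_i by lia. unfold Rdiv. lra. }
  destruct (MVT_gen (fun s => h s - M * (s ^ S j / INR (fact (S j)))) 0 t
    (fun s => dh s - M * (s ^ j / INR (fact j)))) as [c [Hc1 E]].
  - intros s Hs. rewrite Rmin_left in Hs by lra.
    apply (is_derive_minus h (fun s => M * (s ^ S j / INR (fact (S j))))).
    + apply Hd. lra.
    + apply (is_derive_scal (fun s => s ^ S j / INR (fact (S j)))).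
      apply is_derive_pow_fact0.
  - intros s Hs. rewrite Rmin_left in Hs by lra.
    apply continuity_pt_minus.
    + destruct (proj1 Hs) as [H|H]; [|now subst s].
      apply continuity_pt_filterlim, (ex_derive_continuous h).
      exists (dh s). now apply Hd.
    + apply continuity_pt_filterlim.
      apply (ex_derive_continuous (fun s => M * (s ^ S j / INR (fact (S j))))).
      exists (M * (s ^ j / INR (fact j))).
      apply (is_derive_scal (fun s => s ^ S j / INR (fact (S j)))).
      apply is_derive_pow_fact0.
  - rewrite Rmin_left, Rmax_right in Hc1 by lra.
    assert (H := Hb c (proj1 Hc1)).
    assert ((dh c - M * (c ^ j / INR (fact j))) * (t - 0) <= 0) by nra.
    rewrite (pow_i (S j)) in E by lia. unfold Rdiv in E at 2. lra.
Qed.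

(** For a family in which each function is the derivative of the preceding
    one, with derivatives required only at positive times. Applied to the
    tails of the sojourn time and to exponentials. *)
Lemma taylor_remainder (f : nat -> R -> R) (N : nat) (M t : R) :
  (forall k s, 0 < s -> is_derive (f k) s (f (S k) s)) ->
  (forall k, continuity_pt (f k) 0) ->
  (forall s, 0 <= s -> Rabs (f N s) <= M) -> 0 <= t ->
  Rabs (f 0%nat t - taylor (fun k => f k 0) N t) <= M * (t ^ N / INR (fact N)).
Proof.
  revert f t. induction N as [|N IH]; intros f t Hd Hc HM Ht.
  - simpl. rewrite Rminus_0_r. assert (H := HM t Ht). lra.
  - set (h := fun s => f 0%nat s - taylor (fun k => f k 0) (S N) s).
    set (dh := fun s => f 1%nat s - taylor (fun k => f (S k) 0) N s).
    assert (H0 : h 0 = 0) by (unfold h; rewrite taylor_0; ring).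
    assert (Dh : forall s, 0 < s -> is_derive h s (dh s)).
    { intros s Hs. apply (is_derive_minus (f 0%nat) (taylor (fun k => f k 0) (S N))).
      - now apply Hd.
      - apply is_derive_taylor. }
    assert (Ch : continuity_pt h 0).
    { apply continuity_pt_minus; [apply Hc|].
      apply continuity_pt_filterlim, (ex_derive_continuous (taylor (fun k => f k 0) (S N))).
      eexists. apply is_derive_taylor. }
    assert (Bh : forall s, 0 <= s -> Rabs (dh s) <= M * (s ^ N / INR (fact N))).
    { intros s Hs. apply (IH (fun k => f (S k))); auto. }
    assert (B1 : h t - h 0 <= M * (t ^ S N / INR (fact (S N)))).
    { apply (increment_bound h dh); auto. intros s Hs. specialize (Bh s Hs).
      apply Rabs_le_between in Bh. lra. }
    assert (B2 : - h t - - h 0 <= M * (t ^ S N / INR (fact (S N)))).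
    { apply (increment_bound (fun s => - h s) (fun s => - dh s)); auto.
      - intros s Hs. apply (is_derive_opp h). now apply Dh.
      - now apply continuity_pt_opp.
      - intros s Hs. specialize (Bh s Hs). apply Rabs_le_between in Bh. lra. }
    apply Rabs_le. change (- (M * (t ^ S N / INR (fact (S N)))) <= h t
       <= M * (t ^ S N / INR (fact (S N)))). lra.
Qed.

(** * One-sided derivatives *)

Lemma is_derive_nonneg_eps (f : R -> R) (t l : R) :
  is_derive_nonneg f t l -> forall eps : posreal,
  locally t (fun s => 0 <= s -> Rabs (f s - f t - (s - t) * l) <= eps * Rabs (s - t)).
Proof.
  intros [_ H] eps. apply (H t).
  intros P HP. unfold within. apply filter_imp with (2 := HP). auto.
Qed.

Lemma is_derive_nonneg_interior (f : R -> R) (t l : R) :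
  0 < t -> is_derive_nonneg f t l -> is_derive f t l.
Proof.
  intros Ht H. split; [apply is_linear_scal_l|].
  intros x Hx.
  assert (Ex : t = x) by exact (is_filter_lim_locally_unique t x Hx).
  subst x. intros eps.
  assert (Hp : locally t (fun s => 0 < s)).
  { exists (mkposreal t Ht). intros s Hs. change (Rabs (s - t) < t) in Hs.
    apply Rabs_def2 in Hs. lra. }
  apply filter_imp with (2 := filter_and _ _ Hp (is_derive_nonneg_eps f t l H eps)).
  intros s [H1 H2]. apply H2. lra.
Qed.

Lemma is_derive_nonneg_unique (f : R -> R) (t l l' : R) :
  0 <= t -> is_derive_nonneg f t l -> is_derive_nonneg f t l' -> l = l'.
Proof.
  intros Ht H H'. apply Rminus_diag_uniq.
  destruct (Req_dec (l - l') 0) as [|Hne]; [assumption|exfalso].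
  assert (Hp := Rabs_pos_lt _ Hne).
  assert (He : 0 < Rabs (l - l') / 4) by lra.
  destruct (filter_and _ _ (is_derive_nonneg_eps f t l H (mkposreal _ He))
              (is_derive_nonneg_eps f t l' H' (mkposreal _ He))) as [d Hd].
  assert (Hd0 := cond_pos d).
  assert (Hb : ball t d (t + d / 2)).
  { change (Rabs (t + d / 2 - t) < d). rewrite Rabs_pos_eq; lra. }
  destruct (Hd _ Hb) as [H1 H2].
  specialize (H1 ltac:(lra)). specialize (H2 ltac:(lra)). simpl pos in H1, H2.
  replace (t + d / 2 - t) with (d / 2) in * by ring.
  rewrite (Rabs_pos_eq (d / 2)) in * by lra.
  assert (H3 : Rabs (d / 2 * (l - l')) <= Rabs (l - l') * (d / 4)).
  { replace (d / 2 * (l - l')) with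
      ((f (t + d / 2) - f t - d / 2 * l') - (f (t + d / 2) - f t - d / 2 * l)) by ring.
    unfold Rminus at 1. eapply Rle_trans; [apply Rabs_triang|].
    rewrite Rabs_Ropp. lra. }
  rewrite Rabs_mult, (Rabs_pos_eq (d / 2)) in H3 by lra. nra.
Qed.

Lemma is_derive_nonneg_continuity_0 (f : R -> R) (l : R) :
  is_derive_nonneg f 0 l -> continuity_pt (fun s => f (Rabs s)) 0.
Proof.
  intros H. apply continuity_pt_filterlim. apply filterlim_locally. intros eps.
  rewrite Rabs_R0.
  destruct (is_derive_nonneg_eps f 0 l H (mkposreal 1 Rlt_0_1)) as [d Hd].
  assert (Hl := Rabs_pos l).
  assert (He := cond_pos eps). assert (Hd0 := cond_pos d).
  assert (Hq : 0 < eps / (1 + Rabs l)) by (apply Rdiv_lt_0_compat; lra).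
  exists (mkposreal _ (Rmin_pos _ _ Hd0 Hq)). intros s Hs.
  change (Rabs (s - 0) < Rmin d (eps / (1 + Rabs l))) in Hs. rewrite Rminus_0_r in Hs.
  assert (H1 := Rmin_l d (eps / (1 + Rabs l))).
  assert (H2 := Rmin_r d (eps / (1 + Rabs l))).
  assert (Hs0 := Rabs_pos s).
  assert (Hb : ball 0 d (Rabs s)).
  { change (Rabs (Rabs s - 0) < d). rewrite Rminus_0_r, Rabs_Rabsolu. lra. }
  specialize (Hd _ Hb Hs0). simpl pos in Hd.
  rewrite !Rminus_0_r, Rabs_Rabsolu in Hd.
  change (Rabs (f (Rabs s) - f 0) < eps).
  replace (f (Rabs s) - f 0) with ((f (Rabs s) - f 0 - Rabs s * l) + Rabs s * l) by ring.
  eapply Rle_lt_trans; [apply Rabs_triang|].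
  rewrite Rabs_mult, Rabs_Rabsolu.
  apply Rle_lt_trans with (Rabs s * (1 + Rabs l)); [lra|].
  apply Rlt_le_trans with (eps / (1 + Rabs l) * (1 + Rabs l)).
  - apply Rmult_lt_compat_r; lra.
  - right. field. lra.
Qed.

(** * The generator and its moments *)

Definition generator (rho : R) (u : nat -> R) (n : nat) : R :=
  INR n / (INR n + 1) * u (pred n) - (1 + rho / (INR n + 1)) * u n
  + rho / (INR n + 1) * u (S n).

Fixpoint generator_iter (rho : R) (k : nat) (u : nat -> R) : nat -> R :=
  match k with
  | O => u
  | S j => generator rho (generator_iter rho j u)
  end.

Lemma generator_ext (rho : R) (u w : nat -> R) (n : nat) :
  (forall i, u i = w i) -> generator rho u n = generator rho w n.
Proof. intros H. unfold generator. now rewrite !H. Qed.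

(** The rates are bounded, so the generator is a bounded operator for the
    supremum norm. Hence bounded solutions are given by exponential series. *)
Lemma generator_bound (rho M : R) (u : nat -> R) (n : nat) : 0 < rho ->
  (forall i, Rabs (u i) <= M) -> Rabs (generator rho u n) <= (2 + 2 * rho) * M.
Proof.
  intros Hr HM. assert (Hn := pos_INR n). unfold generator.
  assert (Ha : 0 <= INR n / (INR n + 1) <= 1).
  { split; [apply Rdiv_le_0_compat; lra|].
    apply Rmult_le_reg_r with (INR n + 1); [lra|]. field_simplify; lra. }
  assert (Hb : 0 <= rho / (INR n + 1) <= rho).
  { split; [apply Rdiv_le_0_compat; lra|].
    apply Rmult_le_reg_r with (INR n + 1); [lra|]. field_simplify; nra. }
  set (a := INR n / (INR n + 1)) in *. set (b := rho / (INR n + 1)) in *.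
  assert (H1 := HM (pred n)). assert (H2 := HM n). assert (H3 := HM (S n)).
  assert (H0 := Rabs_pos (u n)).
  unfold Rminus. eapply Rle_trans; [apply Rabs_triang|].
  assert (T := Rabs_triang (a * u (pred n)) (- ((1 + b) * u n))).
  rewrite Rabs_Ropp in T. rewrite !Rabs_mult in *.
  rewrite (Rabs_pos_eq a), (Rabs_pos_eq (1 + b)) in T by lra.
  rewrite (Rabs_pos_eq b) by lra.
  assert (a * Rabs (u (pred n)) <= 1 * M)
    by (apply Rmult_le_compat; try lra; apply Rabs_pos).
  assert ((1 + b) * Rabs (u n) <= (1 + rho) * M) by (apply Rmult_le_compat; lra).
  assert (b * Rabs (u (S n)) <= rho * M)
    by (apply Rmult_le_compat; try lra; apply Rabs_pos).
  lra.
Qed.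

Lemma generator_iter_bound (rho M : R) (u : nat -> R) (k n : nat) : 0 < rho ->
  (forall i, Rabs (u i) <= M) ->
  Rabs (generator_iter rho k u n) <= (2 + 2 * rho) ^ k * M.
Proof.
  intros Hr HM. revert n. induction k as [|k IH]; intros n; simpl.
  - rewrite Rmult_1_l. apply HM.
  - rewrite Rmult_assoc. now apply generator_bound.
Qed.

Lemma is_derive_generator_iter (rho : R) (g : R -> nat -> R) (t : R) :
  (forall i, is_derive (fun s => g s i) t (generator rho (g t) i)) ->
  forall k n, is_derive (fun s => generator_iter rho k (g s) n) t
    (generator_iter rho (S k) (g t) n).
Proof.
  intros Hg k. induction k as [|k IH]; intros n; [apply Hg|].
  apply (is_derive_plus
    (fun s => INR n / (INR n + 1) * generator_iter rho k (g s) (pred n)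
       - (1 + rho / (INR n + 1)) * generator_iter rho k (g s) n)
    (fun s => rho / (INR n + 1) * generator_iter rho k (g s) (S n))).
  - apply (is_derive_minus
      (fun s => INR n / (INR n + 1) * generator_iter rho k (g s) (pred n))
      (fun s => (1 + rho / (INR n + 1)) * generator_iter rho k (g s) n)).
    + apply (is_derive_scal (fun s => generator_iter rho k (g s) (pred n))), IH.
    + apply (is_derive_scal (fun s => generator_iter rho k (g s) n)), IH.
  - apply (is_derive_scal (fun s => generator_iter rho k (g s) (S n))), IH.
Qed.

Lemma continuity_generator_iter (rho : R) (g : R -> nat -> R) (t : R) :
  (forall i, continuity_pt (fun s => g s i) t) ->
  forall k n, continuity_pt (fun s => generator_iter rho k (g s) n) t.
Proof.
  intros Hg k. induction k as [|k IH]; intros n; [apply Hg|].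
  apply (continuity_pt_plus
    (fun s => INR n / (INR n + 1) * generator_iter rho k (g s) (pred n)
       - (1 + rho / (INR n + 1)) * generator_iter rho k (g s) n)
    (fun s => rho / (INR n + 1) * generator_iter rho k (g s) (S n))).
  - apply (continuity_pt_minus
      (fun s => INR n / (INR n + 1) * generator_iter rho k (g s) (pred n))
      (fun s => (1 + rho / (INR n + 1)) * generator_iter rho k (g s) n)).
    + apply (continuity_pt_scal (fun s => generator_iter rho k (g s) (pred n))), IH.
    + apply (continuity_pt_scal (fun s => generator_iter rho k (g s) n)), IH.
  - apply (continuity_pt_scal (fun s => generator_iter rho k (g s) (S n))), IH.
Qed.

Lemma generator_spectral_poly (rho x : R) (n : nat) : 0 < rho ->
  generator rho (fun i => spectral_poly rho i x) n = (x - 1) * spectral_poly rho n x.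
Proof.
  intros Hr. assert (Hn := pos_INR n). assert (Q := spectral_poly_S rho n x Hr).
  unfold generator. apply Rmult_eq_reg_l with (INR n + 1); [|lra].
  transitivity ((INR n * spectral_poly rho (pred n) x - rho * spectral_poly rho n x
    + rho * spectral_poly rho (S n) x) - (INR n + 1) * spectral_poly rho n x);
    [field; lra|].
  rewrite <- Q. ring.
Qed.

Definition spectral_moment (rho : R) (k n : nat) : R :=
  spectral_mean rho (fun x => spectral_poly rho n x * (x - 1) ^ k).

Lemma bounded_shifted_pow (rho : R) (k : nat) :
  bounded_on_spectrum rho (fun x => (x - 1) ^ k).
Proof.
  apply (bounded_pow rho (fun x => x - 1)).
  exact (bounded_plus rho _ _ (bounded_id rho) (bounded_const rho (- 1))).
Qed.

(** The moments satisfy the recursion of the iterated generator, by the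
    eigenvalue equation. *)
Lemma generator_spectral_moment (rho : R) (k n : nat) : 0 < rho ->
  generator rho (spectral_moment rho k) n = spectral_moment rho (S k) n.
Proof.
  intros Hr.
  assert (HB : forall c j, bounded_on_spectrum rho
      (fun x => c * (spectral_poly rho j x * (x - 1) ^ k))).
  { intros c j. apply bounded_mult; [apply bounded_const|].
    apply bounded_mult; [apply bounded_spectral_poly|apply bounded_shifted_pow]. }
  unfold spectral_moment at 2.
  rewrite (spectral_mean_ext rho _ (fun x =>
      INR n / (INR n + 1) * (spectral_poly rho (pred n) x * (x - 1) ^ k)
      + (- (1 + rho / (INR n + 1)) * (spectral_poly rho n x * (x - 1) ^ k)
      + rho / (INR n + 1) * (spectral_poly rho (S n) x * (x - 1) ^ k))) Hr).
  - rewrite spectral_mean_plus, spectral_mean_plus, !spectral_mean_scal; auto.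
    + fold (spectral_moment rho k (pred n)) (spectral_moment rho k n)
        (spectral_moment rho k (S n)). unfold generator. ring.
    + apply bounded_plus; apply HB.
  - intros x _. rewrite <- tech_pow_Rmult, <- Rmult_assoc.
    rewrite (Rmult_comm (spectral_poly rho n x)).
    rewrite <- generator_spectral_poly by exact Hr. unfold generator. ring.
Qed.

(** All derivatives at time 0 of the density and of its claimed expansion
    agree. *)
Lemma generator_iter_one (rho : R) (k n : nat) : 0 < rho ->
  generator_iter rho (S k) (fun _ => 1) n = - spectral_moment rho k n.
Proof.
  intros Hr. revert n. induction k as [|k IH]; intros n.
  - assert (Hn := pos_INR n). unfold spectral_moment.
    rewrite (spectral_mean_ext rho _ (spectral_poly rho n) Hr) by (intros; simpl; ring).
    rewrite spectral_mean_poly by exact Hr. simpl. unfold generator. field. lra.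
  - rewrite <- generator_spectral_moment by exact Hr.
    change (generator rho (generator_iter rho (S k) (fun _ => 1)) n
      = - generator rho (spectral_moment rho k) n).
    rewrite (generator_ext rho _ _ n IH). unfold generator. ring.
Qed.

Lemma exp_le_1_of_nonpos (y : R) : y <= 0 -> exp y <= 1.
Proof.
  intros [Hy|Hy]; rewrite <- exp_0.
  - left. now apply exp_increasing.
  - subst y. lra.
Qed.

Lemma exp_taylor_bound (v a t : R) (N : nat) : - a <= v <= 0 -> 0 <= t ->
  Rabs (exp (v * t) - taylor (fun k => v ^ k) N t) <= a ^ N * (t ^ N / INR (fact N)).
Proof.
  intros Hv Ht.
  assert (D : forall k s, is_derive (fun s => v ^ k * exp (v * s)) s
     (v ^ S k * exp (v * s))).
  { intros k s. auto_derive; [easy|]. simpl. ring. }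
  assert (H := taylor_remainder (fun k s => v ^ k * exp (v * s)) N (a ^ N) t).
  rewrite (taylor_ext _ (fun k => v ^ k) N t) in H
    by (intros k; rewrite Rmult_0_r, exp_0; ring).
  simpl in H. rewrite Rmult_1_l in H. apply H; auto.
  - intros k. apply continuity_pt_filterlim.
    apply (ex_derive_continuous (fun s => v ^ k * exp (v * s))). eexists. apply D.
  - intros s Hs. rewrite Rabs_mult, <- RPow_abs.
    assert (He : 0 < exp (v * s) <= 1).
    { split; [apply exp_pos|]. apply exp_le_1_of_nonpos. nra. }
    rewrite (Rabs_pos_eq (exp _)) by lra.
    assert (Rabs v ^ N <= a ^ N).
    { apply pow_incr. split; [apply Rabs_pos|apply Rabs_le; lra]. }
    assert (0 <= Rabs v ^ N) by (apply pow_le, Rabs_pos). nra.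
Qed.

Lemma bounded_taylor (rho t : R) (N : nat) :
  bounded_on_spectrum rho (fun x => taylor (fun k => (x - 1) ^ k) N t).
Proof.
  induction N as [|N IH]; [exact (bounded_const rho 0)|].
  exact (bounded_plus rho _ _ IH
    (bounded_mult rho _ _ (bounded_shifted_pow rho N) (bounded_const rho _))).
Qed.

Lemma spectral_mean_taylor (rho t : R) (N n : nat) : 0 < rho ->
  spectral_mean rho (fun x => spectral_poly rho n x * taylor (fun k => (x - 1) ^ k) N t)
  = taylor (fun k => spectral_moment rho k n) N t.
Proof.
  intros Hr. induction N as [|N IH].
  - simpl. rewrite (spectral_mean_ext rho _ (fun x => 0 * x) Hr) by (intros; ring).
    rewrite spectral_mean_scal. ring.
  - simpl taylor. rewrite <- IH.
    rewrite (spectral_mean_ext rho _ (fun x =>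
      spectral_poly rho n x * taylor (fun k => (x - 1) ^ k) N t
      + t ^ N / INR (fact N) * (spectral_poly rho n x * (x - 1) ^ N)) Hr)
      by (intros; ring).
    rewrite spectral_mean_plus, spectral_mean_scal; auto.
    + unfold spectral_moment. ring.
    + apply bounded_mult; [apply bounded_spectral_poly|apply bounded_taylor].
    + apply bounded_mult; [apply bounded_const|].
      apply bounded_mult; [apply bounded_spectral_poly|apply bounded_shifted_pow].
Qed.

Lemma bounded_exp (rho t : R) : 0 <= t ->
  bounded_on_spectrum rho (fun x => exp ((x - 1) * t)).
Proof.
  intros Ht. exists 1. intros x [_ Hx].
  rewrite Rabs_pos_eq by (left; apply exp_pos).
  apply exp_le_1_of_nonpos. nra.
Qed.

(** Replacing exp by its Taylor polynomial under the spectral mean avoids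
    exchanging two infinite sums. *)
Lemma spectral_mean_exp_taylor (rho t : R) (n : nat) : 0 < rho -> 0 <= t ->
  exists M, 0 <= M /\ forall N,
  Rabs (spectral_mean rho (fun x => spectral_poly rho n x * exp ((x - 1) * t))
        - taylor (fun k => spectral_moment rho k n) N t)
  <= M * (((2 + 2 * rho) * t) ^ N / INR (fact N)).
Proof.
  intros Hr Ht. destruct (bounded_spectral_poly rho n) as [M HM]. exists (Rabs M).
  split; [apply Rabs_pos|]. intros N.
  rewrite <- spectral_mean_taylor by exact Hr.
  assert (E : spectral_mean rho (fun x => spectral_poly rho n x * exp ((x - 1) * t))
     = spectral_mean rho (fun x => spectral_poly rho n x
          * taylor (fun k => (x - 1) ^ k) N t)
     + spectral_mean rho (fun x => spectral_poly rho n x *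
          (exp ((x - 1) * t) + -1 * taylor (fun k => (x - 1) ^ k) N t))).
  { rewrite <- spectral_mean_plus; [|exact Hr| |].
    - apply spectral_mean_ext; [exact Hr|]. intros; ring.
    - apply bounded_mult; [apply bounded_spectral_poly|apply bounded_taylor].
    - apply bounded_mult; [apply bounded_spectral_poly|].
      apply bounded_plus; [now apply bounded_exp|].
      apply bounded_mult; [apply bounded_const|apply bounded_taylor]. }
  rewrite E, Rplus_minus_l.
  apply spectral_mean_abs_le; [exact Hr|]. intros x Hx. rewrite Rabs_mult.
  apply Rmult_le_compat; try apply Rabs_pos.
  - eapply Rle_trans; [apply HM, Hx|apply Rle_abs].
  - unfold in_spectrum in Hx.
    assert (Hv : - (2 + 2 * rho) <= x - 1 <= 0) by lra.
    assert (B := exp_taylor_bound (x - 1) (2 + 2 * rho) t N Hv Ht).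
    rewrite Rpow_mult_distr. unfold Rdiv at 1. rewrite Rmult_assoc.
    eapply Rle_trans; [|exact B]. right. f_equal. ring.
Qed.

Lemma eq_of_factorial_bound (a b c y : R) :
  (forall N, Rabs (a - b) <= c * (y ^ N / INR (fact N))) -> a = b.
Proof.
  intros H. apply Rminus_diag_uniq.
  assert (L : is_lim_seq (fun N => c * (y ^ N / INR (fact N))) 0).
  { replace (Finite 0) with (Rbar_mult c 0) by (simpl; f_equal; ring).
    apply is_lim_seq_scal_l. apply is_lim_seq_Reals, cv_speed_pow_fact. }
  assert (H0 := is_lim_seq_le _ _ (Rabs (a - b)) 0 H (is_lim_seq_const _) L).
  simpl in H0. assert (H1 := Rabs_pos (a - b)).
  destruct (Req_dec (a - b) 0) as [|Hn]; [assumption|].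
  apply Rabs_pos_lt in Hn. lra.
Qed.

(** * The density *)

(** Both sides have the same Taylor polynomials at 0, and both remainders of
    order N are at most a constant times ((2 + 2 rho) t)^N / N!. *)
Lemma density_eq_spectral_mean (rho : R) (p : nat -> R -> R) (n : nat) (t : R) :
  0 < rho -> sojourn_density rho p -> 0 <= t ->
  p n t = spectral_mean rho (fun x => spectral_poly rho n x * exp ((x - 1) * t)).
Proof.
  intros Hr [V [[HV0 [HVb HVd]] HVp]] Ht.
  assert (Hp : p n t = - generator rho (fun i => V i t) n).
  { assert (E := is_derive_nonneg_unique _ _ _ _ Ht (HVp n t Ht) (HVd n t Ht)).
    unfold generator. lra. }
  (* reflecting time turns one-sided continuity at 0 into a two-sided one *)
  set (g := fun (s : R) (i : nat) => V i (Rabs s)).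
  assert (Dg : forall s, 0 < s -> forall i,
     is_derive (fun s => g s i) s (generator rho (g s) i)).
  { intros s Hs i. apply is_derive_ext_loc with (V i).
    - exists (mkposreal s Hs). intros w Hw. change (Rabs (w - s) < s) in Hw.
      apply Rabs_def2 in Hw. unfold g. rewrite Rabs_pos_eq by lra. reflexivity.
    - apply is_derive_nonneg_interior; [exact Hs|].
      unfold generator, g. rewrite Rabs_pos_eq by lra. apply HVd. lra. }
  assert (Cg : forall i, continuity_pt (fun s => g s i) 0).
  { intros i. apply is_derive_nonneg_continuity_0 with (1 := HVd i 0 (Rle_refl 0)). }
  assert (Bg : forall s i, Rabs (g s i) <= 1).
  { intros s i. assert (H := HVb i (Rabs s) (Rabs_pos s)). unfold g.
    rewrite Rabs_pos_eq; lra. }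
  assert (T : forall N, Rabs (- p n t - taylor (fun k => - spectral_moment rho k n) N t)
     <= (2 + 2 * rho) * (((2 + 2 * rho) * t) ^ N / INR (fact N))).
  { intros N.
    assert (H := taylor_remainder (fun k s => generator_iter rho (S k) (g s) n) N
      ((2 + 2 * rho) ^ S N * 1) t).
    rewrite (taylor_ext _ (fun k => - spectral_moment rho k n) N t) in H.
    - replace (- p n t) with (generator_iter rho 1 (g t) n).
      + eapply Rle_trans; [apply H|].
        * intros k s Hs. apply is_derive_generator_iter. now apply Dg.
        * intros k. now apply continuity_generator_iter.
        * intros s Hs. now apply generator_iter_bound.
        * exact Ht.
        * rewrite Rpow_mult_distr, <- tech_pow_Rmult. unfold Rdiv. lra.
      + rewrite Hp. simpl. unfold g. rewrite Rabs_pos_eq by exact Ht. ring.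
    - intros k. rewrite <- generator_iter_one by exact Hr.
      assert (E : forall j m, generator_iter rho j (g 0) m
                   = generator_iter rho j (fun _ => 1) m).
      { induction j as [|j IH]; intros m; simpl.
        - unfold g. rewrite Rabs_R0. apply HV0.
        - now apply generator_ext. }
      apply E. }
  destruct (spectral_mean_exp_taylor rho t n Hr Ht) as [M [HM0 HM]].
  apply eq_of_factorial_bound with ((2 + 2 * rho) + M) ((2 + 2 * rho) * t).
  intros N. specialize (T N). specialize (HM N).
  set (q := spectral_mean rho _) in *.
  assert (E : taylor (fun k => - spectral_moment rho k n) N t
            = - taylor (fun k => spectral_moment rho k n) N t).
  { clear. induction N as [|N IH]; simpl; [ring|]. rewrite IH. ring. }
  rewrite E in T. apply Rabs_le_between in T. apply Rabs_le_between in HM.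
  apply Rabs_le. lra.
Qed.

Lemma spectral_term_eq (rho : R) (n : nat) (t : R) (k : nat) (v : R) : 0 < rho ->
  v + 1 <> 0 -> INR (S k) * (v + 1) ^ 2 + rho * (v + 1) - rho = 0 ->
  Ccoef (S k) v * (spectral_poly rho n (v + 1) * exp ((v + 1 - 1) * t))
  = spectral_term rho n t (S k) v.
Proof.
  intros Hr Hv E. unfold spectral_term. rewrite phi_eq_spectral_poly by assumption.
  replace (v + 1 - 1) with v by ring. ring.
Qed.

(* Both sums run over m >= 1, whence the index shift m = S k. *)
Theorem theorem2p1 (rho : R) (hrho : 0 < rho) (p : nat -> R -> R)
    (hp : sojourn_density rho p) (n : nat) (t : R) (ht : 0 <= t) :
  ex_series (fun k => spectral_term rho n t (S k) (nu rho (S k))) /\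
  ex_series (fun k => spectral_term rho n t (S k) (nu_tilde rho (S k))) /\
  p n t = Series (fun k => spectral_term rho n t (S k) (nu rho (S k)))
        + Series (fun k => spectral_term rho n t (S k) (nu_tilde rho (S k))).
Proof.
  assert (HB : bounded_on_spectrum rho
    (fun x => spectral_poly rho n x * exp ((x - 1) * t))).
  { apply bounded_mult; [apply bounded_spectral_poly|now apply bounded_exp]. }
  destruct (ex_series_spectral rho _ hrho HB) as [H1 H2].
  assert (E1 : forall k, Ccoef (S k) (nu rho (S k)) *
     (spectral_poly rho n (nu rho (S k) + 1) * exp ((nu rho (S k) + 1 - 1) * t))
     = spectral_term rho n t (S k) (nu rho (S k))).
  { intros k. destruct (nu_root rho k hrho) as [Hx Ex].
    apply spectral_term_eq; [exact hrho|lra|exact Ex]. }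
  assert (E2 : forall k, Ccoef (S k) (nu_tilde rho (S k)) *
     (spectral_poly rho n (nu_tilde rho (S k) + 1) * exp ((nu_tilde rho (S k) + 1 - 1) * t))
     = spectral_term rho n t (S k) (nu_tilde rho (S k))).
  { intros k. destruct (nu_tilde_root rho k hrho) as [Hx Ex].
    apply spectral_term_eq; [exact hrho|lra|exact Ex]. }
  split; [|split].
  - exact (ex_series_ext _ _ E1 H1).
  - exact (ex_series_ext _ _ E2 H2).
  - rewrite (density_eq_spectral_mean rho p n t hrho hp ht).
    rewrite <- (Series_ext _ _ E1), <- (Series_ext _ _ E2).
    exact (Series_plus _ _ H1 H2).
Qed.
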